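(* Let $M$ be a compact connected smooth manifold (without boundary) and let $X$ be a cohomology free vector field on $M$. Assume there are a smooth manifold $N$, a smooth fibration $p:M\to N$ and a smooth vector field $Y$ on $N$ such that $p_*X=Y$, i.e. $d_xp(X(x))=Y(p(x))$ for every $x\in M$. Then $Y$ is a cohomology free vector field on $N$.
   Context: Smooth means $C^\infty$. A smooth vector field $Z$ on a manifold $P$ is called cohomology free if for every smooth function $\phi:P\to\mathbb{R}$ there exist a constant $c\in\mathbb{R}$ and a smooth function $u:P\to\mathbb{R}$ with $\mathcal{L}_Zu=\phi+c$, where $\mathcal{L}_Zu$ is the Lie derivative of $u$ along $Z$. A smooth fibration is a smooth locally trivial fiber bundle projection (for compact $M$, equivalently a surjective smooth submersion). *)

(* Defs.v *)
From mathcomp Require Import all_boot all_order all_algebra.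
From mathcomp Require Import all_classical all_reals all_analysis.

Set Implicit Arguments.
Unset Strict Implicit.
Unset Printing Implicit Defensive.

Import Order.TTheory GRing.Theory Num.Theory.
Import numFieldNormedType.Exports.

Local Open Scope classical_set_scope.
Local Open Scope ring_scope.

Section Euclidean.
Variables (R : realType) (n : nat).

Definition partial (i : 'I_n) (f : 'rV[R]_n -> R) : 'rV[R]_n -> R :=
  fun x => 'D_(delta_mx 0 i) f x.

(* Meant for an open V: then the partial derivatives at points of V depend
   only on the values of f on V. *)
Fixpoint C_on (k : nat) (V : set 'rV[R]_n) (f : 'rV[R]_n -> R) : Prop :=
  {within V, continuous f} /\
  (if k is k'.+1 then
     forall i : 'I_n, (forall x, V x -> derivable f x (delta_mx 0 i)) /\
                      C_on k' V (partial i f)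
   else True).

Definition smooth_on (V : set 'rV[R]_n) (f : 'rV[R]_n -> R) : Prop :=
  forall k, C_on k V f.

End Euclidean.

(* The values of [coord] outside [chart_dom], and those of [param] outside
   the image of [coord], are irrelevant. *)
Record chart (R : realType) (T : topologicalType) (n : nat) := Chart {
  chart_dom : set T;
  coord : T -> 'rV[R]_n;
  param : 'rV[R]_n -> T }.

Definition chart_axiom (R : realType) (T : topologicalType) (n : nat)
    (c : chart R T n) : Prop :=
  [/\ open (chart_dom c),
      open (coord c @` chart_dom c),
      (forall x, chart_dom c x -> param c (coord c x) = x),
      {within chart_dom c, continuous (coord c)} &
      {within coord c @` chart_dom c, continuous (param c)}].

Record chartedSpace (R : realType) := ChartedSpace {
  carrier :> topologicalType;
  dim : nat;
  atlas : set (chart R carrier dim) }.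

Section Smoothness.
Variable R : realType.

Definition smooth_function (M : chartedSpace R) (phi : M -> R) : Prop :=
  forall c, atlas (c := M) c ->
    smooth_on (coord c @` chart_dom c) (phi \o param c).

(* Meant for an open A. *)
Definition smooth_map_on (M N : chartedSpace R) (A : set M) (f : M -> N) :
    Prop :=
  {within A, continuous f} /\
  forall c d, atlas (c := M) c -> atlas (c := N) d ->
    forall j, smooth_on
      (coord c @` (chart_dom c `&` A `&` f @^-1` chart_dom d))
      (fun v => coord d (f (param c v)) 0 j).

Definition smooth_map (M N : chartedSpace R) (f : M -> N) : Prop :=
  smooth_map_on setT f.

Definition prod_chart (S T : topologicalType) (m n : nat)
    (c : chart R S m) (d : chart R T n) : chart R (S * T)%type (m + n) :=
  {| chart_dom := chart_dom c `*` chart_dom d;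
     coord := fun z => row_mx (coord c z.1) (coord d z.2);
     param := fun v => (param c (lsubmx v), param d (rsubmx v)) |}.

Definition prod_space (M N : chartedSpace R) : chartedSpace R :=
  {| carrier := (M * N)%type;
     dim := dim M + dim N;
     atlas := [set e | exists c d, [/\ atlas (c := M) c, atlas (c := N) d &
                                       e = prod_chart c d]] |}.

Definition diffeomorphism_on (M N : chartedSpace R) (A : set M) (B : set N)
    (f : M -> N) (g : N -> M) : Prop :=
  [/\ smooth_map_on A f, smooth_map_on B g,
      (forall x, A x -> B (f x) /\ g (f x) = x) &
      (forall y, B y -> A (g y) /\ f (g y) = y)].

End Smoothness.

(* The atlas is not required to be maximal: the smooth structure is the one
   it generates, and the notions of smoothness above only depend on that. *)
Record smoothManifold (R : realType) := SmoothManifold {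
  mspace :> chartedSpace R;
  manifold_hausdorff : hausdorff_space mspace;
  manifold_second_countable : @second_countable mspace;
  atlas_charts : forall c, atlas (c := mspace) c -> chart_axiom c;
  atlas_cover : forall x : mspace,
    exists c, atlas (c := mspace) c /\ chart_dom c x;
  atlas_compat : forall c d, atlas (c := mspace) c -> atlas (c := mspace) d ->
    forall j, smooth_on (coord c @` (chart_dom c `&` chart_dom d))
      (fun v => coord d (param c v) 0 j) }.

Definition smooth_fibration (R : realType) (M N : smoothManifold R)
    (p : M -> N) : Prop :=
  [/\ smooth_map p,
      (forall y, exists x, p x = y) &
      exists F : smoothManifold R, forall y : N,
        exists (U : set N) (Phi : M -> prod_space N F)
               (Psi : prod_space N F -> M),
          [/\ open U, U y,
              diffeomorphism_on (N := prod_space N F)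
                (p @^-1` U) (U `*` [set: F]) Phi Psi &
              (forall x, U (p x) -> (Phi x).1 = p x)]].

Section VectorFields.
Variable R : realType.

(* Tangent vectors are derivations of the algebra of smooth functions. They
   are represented by functionals on all functions, whose values on
   non-smooth functions are irrelevant: hence [tangent_eq]. *)
Definition tangent_vector (M : smoothManifold R) (x : M) (v : (M -> R) -> R) :
    Prop :=
  (forall (a : R) (f g : M -> R), smooth_function f -> smooth_function g ->
     v (fun z => a * f z + g z) = a * v f + v g) /\
  (forall f g : M -> R, smooth_function f -> smooth_function g ->
     v (fun z => f z * g z) = f x * v g + v f * g x).

Definition tangent_eq (M : smoothManifold R) (v w : (M -> R) -> R) : Prop :=
  forall f : M -> R, smooth_function f -> v f = w f.

Definition differential (M N : smoothManifold R) (p : M -> N)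
    (v : (M -> R) -> R) : (N -> R) -> R := fun f => v (f \o p).

Record vectorField (M : smoothManifold R) := VectorField {
  vf_at :> M -> (M -> R) -> R;
  vf_tangent : forall x, tangent_vector x (vf_at x);
  vf_smooth : forall f : M -> R, smooth_function f ->
    smooth_function (fun x => vf_at x f) }.

(* du(Z), the derivation Z(x) being evaluated on u. *)
Definition lie_derivative (M : smoothManifold R) (Z : vectorField M)
    (u : M -> R) : M -> R := fun x => Z x u.

Definition cohomology_free (M : smoothManifold R) (Z : vectorField M) : Prop :=
  forall phi : M -> R, smooth_function phi ->
    exists (c : R) (u : M -> R), smooth_function u /\
      forall x, lie_derivative Z u x = phi x + c.

End VectorFields.

(* Main.v *)
From Pilot Require Import Defs.
From mathcomp Require Import all_boot all_order all_algebra.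
From mathcomp Require Import all_classical all_reals all_analysis.
From mathcomp Require Import ring lra.

(* If Y w = phi + c, then u - w o p is killed by X, where X u = phi o p + c; so u
   has to be constant on the fibres of p. This is proved directly, and w is then
   the function induced by u, smooth because p has local sections.

   Let d be the maximum of u(z1) - u(z2) over the pairs with p z1 = p z2, and
   suppose d > 0. Take h >= 0 smooth, positive exactly where u < min u + d/2, and
   s with X s = h + c. For K large, a pair (x1, x2) maximizing
   K (u(z1) - u(z2)) + s(z1) over the fibre product satisfies
   u(x1) - u(x2) >= d/2, hence h(x1) = 0; since X u takes the same value at x1 and
   x2, the vanishing of the derivative at this maximum reads h(x1) + c = 0. So
   c = 0 and X s = h >= 0, and a function whose Lie derivative along a cohomology
   free field is nonnegative is constant. Thus h = 0, a contradiction at the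
   minimum of u. *)

Set Implicit Arguments.
Unset Strict Implicit.
Unset Printing Implicit Defensive.

Import Order.TTheory GRing.Theory Num.Theory.
Import numFieldNormedType.Exports.
Import Pilot.Defs.

Local Open Scope classical_set_scope.
Local Open Scope ring_scope.

(** * Differential calculus in coordinates *)

Section DirectionalDerivatives.
Variables (R : realType) (V : normedModType R).

(** Without [s], the first-order condition at a maximum of u(z1) - u(z2) over the fibre product says
    nothing, because X u agrees at the two points. The term [s] is a perturbation with prescribed
    derivative h + c. The two contributions of K u to the condition cancel for every K, so K can be
    taken large enough to keep the maximum where u(x1) - u(x2) >= d/2 while the condition itself
    does not depend on K. An X-invariant measure of full support would at once forbid c = 0 with h
    nonnegative and nonzero; [nonneg_lie_derivative_cst] takes its place. Tangent vectors are
    derivations of the algebra of global smooth functions, so even the vanishing of a derivative at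
    a maximum has to be derived: it comes from Hadamard's lemma, with bump functions making the
    local factors global. This accounts for the flat functions and the radial integrals. *)

Lemma growth_rate_line (W : normedModType R) (f : V -> W) (v y : V) (t : R) :
  (fun h : R => h^-1 *: (f ((h + t) *: v + y) - f (t *: v + y))) =
  (fun h : R => h^-1 *: (f (h *: v + (t *: v + y)) - f (t *: v + y))).
Proof. by apply/funext => h; rewrite scalerDl addrA. Qed.

Lemma derive_line (W : normedModType R) (f : V -> W) (v y : V) (t : R) :
  'D_1 (fun s : R => f (s *: v + y)) t = 'D_v f (t *: v + y).
Proof.
rewrite /derive /=; under eq_fun do rewrite [_%:A]mulr1.
by rewrite growth_rate_line.
Qed.

Lemma derivable_line (W : normedModType R) (f : V -> W) (v y : V) (t : R) :
  derivable f (t *: v + y) v <-> derivable (fun s : R => f (s *: v + y)) t 1.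
Proof.
rewrite /derivable -growth_rate_line /=.
suff -> : (fun h : R => h^-1 *: (f ((h + t) *: v + y) - f (t *: v + y))) =
  (fun h : R => h^-1 *: (f ((h%:A + t) *: v + y) - f (t *: v + y))) by [].
by apply/funext => h; rewrite [_%:A]mulr1.
Qed.

(** Since [q] has only a derivative along [v], the one-variable chain rule is applied to its
    restriction to the line through [x]. *)
Lemma is_derive_comp1 (g : R -> R) (q : V -> R) (x v : V) :
  derivable g (q x) 1 -> derivable q x v ->
  is_derive x v (g \o q) (g^`()%classic (q x) * 'D_v q x).
Proof.
move=> dg dq.
pose p := fun s : R => q (s *: v + x).
have p0 : p 0 = q x by rewrite /p scale0r add0r.
have dp : derivable p 0 1 by apply/derivable_line; rewrite scale0r add0r.
have dg0 : derivable g (p 0) 1 by rewrite p0.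
have E := @derive1_comp _ p g 0 dp dg0.
apply: DeriveDef.
  have := @derivable_line _ (g \o q) v x 0; rewrite scale0r add0r => ->.
  move/derivable1_diffP in dp; move/derivable1_diffP in dg0.
  by have /derivable1_diffP := differentiable_comp dp dg0.
have := @derive_line _ (g \o q) v x 0; rewrite scale0r add0r => <-.
move: E; rewrite !derive1E p0 => E; rewrite -[LHS]/('D_1 (g \o p) 0) E.
by congr (_ * _); rewrite derive_line scale0r add0r.
Qed.

Lemma derive_bound_le (f : V -> R) (v y : V) (a b M : R) : a <= b ->
  (forall t : R, a <= t <= b -> derivable f (t *: v + y) v) ->
  (forall t : R, a <= t <= b -> `|'D_v f (t *: v + y)| <= M) ->
  `|f (b *: v + y) - f (a *: v + y)| <= M * (b - a).
Proof.
move=> ab df dM; pose g (t : R) := f (t *: v + y).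
have dg t : a <= t <= b -> derivable g t 1.
  by move=> tab; apply/derivable_line; exact: df.
have [| |c] := @MVT_segment R g (fun t => 'D_1 g t) a b ab.
- move=> t; rewrite in_itv/= => /andP[/ltW at_ /ltW tb].
  by apply: DeriveDef => //; apply: dg; rewrite at_.
- apply: continuous_in_subspaceT.
  move=> s /set_mem; rewrite /= in_itv/= => sab.
  by apply/differentiable_continuous/derivable1_diffP; exact: dg.
- rewrite in_itv/= => cab; rewrite /g => ->.
  by rewrite normrM (ger0_norm (_ : 0 <= b - a)) ?subr_ge0// ler_wpM2r ?subr_ge0// derive_line dM.
Qed.

Lemma derive_bound (f : V -> R) (v y : V) (s M : R) :
  (forall t : R, `|t| <= `|s| -> derivable f (t *: v + y) v) ->
  (forall t : R, `|t| <= `|s| -> `|'D_v f (t *: v + y)| <= M) ->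
  `|f (s *: v + y) - f y| <= M * `|s|.
Proof.
move=> df dM; have [s0|s0] := lerP 0 s.
  have tl (t : R) : 0 <= t <= s -> `|t| <= `|s|.
    by case/andP=> t0 ts; rewrite !ger0_norm.
  have := @derive_bound_le f v y 0 s M s0 (fun t st => df t (tl t st)) (fun t st => dM t (tl t st)).
  by rewrite scale0r add0r subr0 (ger0_norm s0).
have tl (t : R) : s <= t <= 0 -> `|t| <= `|s|.
  by case/andP=> st t0; rewrite !ler0_norm ?lerN2// ltW.
have := @derive_bound_le f v y s 0 M (ltW s0) (fun t st => df t (tl t st)) (fun t st => dM t (tl t st)).
by rewrite scale0r add0r distrC (ltr0_norm s0) sub0r.
Qed.

End DirectionalDerivatives.

Section Differentiability.
Variables (R : realType) (n : nat).
Implicit Types (f : 'rV[R]_n -> R) (x : 'rV[R]_n).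

Local Notation e_ i := (delta_mx 0 i : 'rV[R]_n).

Lemma differentiable_negligible f x :
  (forall e, 0 < e -> \forall h \near (0 : 'rV[R]_n),
     `|f (h + x) - f x| <= e * `|h|) -> differentiable f x.
Proof.
move=> fo; apply/diff_locallyP.
have H : f \o shift x = cst (f x) + (\0 : 'rV[R]_n -> R) +o_ (0 : 'rV[R]_n) id.
  apply/eqaddoP => e e0; have := fo e e0; apply: filterS => h /=.
  rewrite !fctE /=.
  by rewrite /cst /= addr0.
have /= E := @diff_unique _ _ _ f \0 x (@cst_continuous _ _ 0) H.
rewrite E; split=> //; exact: cst_continuous.
Qed.

Lemma mx_norm_entry_le x (i : 'I_n) : `|x 0 i| <= `|x|.
Proof.
rewrite [leRHS]/Num.Def.normr/= mx_normrE.
exact: (le_bigmax _ (fun ij => `|x ij.1 ij.2|) (0, i)).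
Qed.

Lemma mx_norm_le x (M : R) : 0 <= M -> (forall i, `|x 0 i| <= M) -> `|x| <= M.
Proof.
move=> M0 H; rewrite [leLHS]/Num.Def.normr/= mx_normrE (bigmax_le _ M0)//=.
by move=> [i j] _ /=; rewrite ord1.
Qed.

(** The increment is split along a path parallel to the axes, and the mean value inequality
    [derive_bound] controls each piece. *)
Lemma differentiable_negligible_partial f x :
  (forall i, \forall y \near x, derivable f y (e_ i)) ->
  (forall i (e : R), 0 < e -> \forall y \near x, `|partial i f y| <= e) ->
  differentiable f x.
Proof.
move=> df pf; apply: differentiable_negligible => e e0.
(* [n.+1] avoids a division by zero in dimension 0; the n pieces still add up to at most e |h|. *)
pose e' := e / n.+1%:R; have e'0 : 0 < e' by rewrite divr_gt0.
have : \forall y \near x, forall i : 'I_n, derivable f y (e_ i) /\ `|partial i f y| <= e'.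
  exact: (filter_forall _ (fun i => filterI (df i) (pf i _ e'0))).
move=> /nbhs_normP[d /= d0 Hd]; apply/nbhs_normP; exists d => //= h.
rewrite /ball_ /= sub0r normrN => hd.
(* The corners of the path from 0 to h: the first j coordinates have been moved. *)
pose H (j : nat) : 'rV[R]_n := \row_k (if (k < j)%N then h 0 k else 0).
have Hn : H n = h.
  by apply/rowP => k; rewrite mxE ltn_ord.
have H0 : H 0%N = 0 by apply/rowP => k; rewrite !mxE.
have HS (j : 'I_n) : H j.+1 = h 0 j *: e_ j + H j.
  apply/rowP => k; rewrite !mxE /= ltnS leq_eqVlt.
  have [->|kj] := eqVneq k j; first by rewrite eqxx ltnn mulr1 addr0.
  by rewrite (inj_eq val_inj) (negbTE kj) mulr0 add0r.
have -> : f (h + x) - f x = \sum_(j < n) (f (H j.+1 + x) - f (H j + x)).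
  rewrite -(big_mkord xpredT (fun j => f (H j.+1 + x) - f (H j + x))).
  by rewrite (telescope_sumr (fun j => f (H j + x)))// Hn H0 add0r.
have step (j : 'I_n) : `|f (H j.+1 + x) - f (H j + x)| <= e' * `|h 0 j|.
  (* The norm is the sup norm, so shrinking coordinates of h does not leave the ball. *)
  have nb (t : R) : `|t| <= `|h 0 j| -> `|x - (t *: e_ j + (H j + x))| < d.
    move=> th; apply: le_lt_trans hd.
    have -> : x - (t *: e_ j + (H j + x)) = - (t *: e_ j + H j).
      by rewrite addrA opprD addrCA subrr addr0.
    rewrite normrN; apply: mx_norm_le => // k; rewrite !mxE /=.
    have [->|kj] := eqVneq k j; first by rewrite ltnn addr0 mulr1 (le_trans th)// mx_norm_entry_le.
    by rewrite mulr0 add0r; case: ifP => _; rewrite ?normr0 ?mx_norm_entry_le.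
  rewrite HS -addrA; apply: derive_bound => t th.
    by have [] := Hd _ (nb t th) j.
  by have [] := Hd _ (nb t th) j.
apply: (@le_trans _ _ (\sum_(j < n) e' * `|h|)).
  apply: (le_trans (ler_norm_sum _ _ _)); apply: ler_sum => j _.
  apply: (le_trans (step j)); rewrite ler_wpM2l ?(ltW e'0)//; exact: mx_norm_entry_le.
rewrite sumr_const card_ord -mulr_natr mulrAC ler_wpM2r// /e'.
rewrite -mulrA ler_piMr ?(ltW e0)// mulrC ler_pdivrMr// mul1r ler_nat//.
Qed.

(** Subtracting the linear map [g] built from the partial derivatives at [x] leaves a function whose
    partial derivatives are small near [x]. *)
Lemma differentiable_partial f x :
  (forall i, \forall y \near x, derivable f y (e_ i)) ->
  (forall i, {for x, continuous (partial i f)}) ->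
  differentiable f x.
Proof.
move=> df cf.
pose g (y : 'rV[R]_n) := \sum_(i < n) partial i f x * y 0 i.
have dgi (i : 'I_n) y : differentiable (fun y : 'rV[R]_n => partial i f x * y 0 i) y.
  by apply: (@differentiableZ _ _ _ (fun y : 'rV[R]_n => y 0 i)); exact: differentiable_coord.
have dg y : differentiable g y.
  have -> : g = \sum_(i < n) (fun y : 'rV[R]_n => partial i f x * y 0 i).
    by apply/funext => z; rewrite fct_sumE.
  exact: differentiable_sum.
have pg i y : partial i g y = partial i f x.
  rewrite /partial -[y]add0r -(scale0r (e_ i)) -derive_line.
  rewrite (_ : (fun s : R => _) = (fun s : R => partial i f x *: s + g y)); last first.
    apply/funext => s; rewrite /g.
    under eq_bigr do rewrite !mxE mulrDr eq_sym.
    rewrite big_split /=; congr (_ + _).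
    rewrite (bigD1 i)//= eqxx mulr1 big1 ?addr0// => j ji.
    by rewrite eq_sym (negbTE ji) mulr0 mulr0.
  by rewrite deriveD// derive_cst addr0 deriveZ//= derive_id [_ *: _]mulr1.
have -> : f = (f - g) + g by apply/funext => y; rewrite !fctE subrK.
apply: differentiableD => //.
apply: differentiable_negligible_partial => i.
  apply: filterS (df i) => y dfy; apply: (@derivableB _ _ _ f g _ _ dfy).
  by apply: diff_derivable; exact: dg.
move=> e e0; have := cf i; move=> /cvgrPdist_le /(_ _ e0).
apply: filterS2 (df i) => y dfy; rewrite distrC.
have -> : partial i (f - g) y = partial i f y - partial i f x.
  by rewrite -(pg i y); apply: (@deriveB _ _ _ f g _ _ dfy); apply: diff_derivable; exact: dg.
by [].
Qed.

End Differentiability.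

(** Here too the inner function is only derivable along [v]; on a line it becomes a differentiable
    curve, to which [diff_comp] applies. *)
Lemma is_derive_comp_rV (R : realType) (m : nat) (V : normedModType R)
    (f : 'rV[R]_m -> R) (g : V -> 'rV[R]_m) (x v : V) :
  differentiable f (g x) -> (forall j, derivable (fun y => g y 0 j) x v) ->
  is_derive x v (f \o g)
    (\sum_j 'D_v (fun y => g y 0 j) x * partial j f (g x)).
Proof.
move=> df dg.
have dgx : derivable g x v by apply/derivable_mxP => i j; rewrite ord1.
pose p := fun s : R => g (s *: v + x).
have p0 : p 0 = g x by rewrite /p scale0r add0r.
have dp : derivable p 0 1.
  by apply/derivable_line; rewrite scale0r add0r.
have dp' : differentiable p 0 by apply/derivable1_diffP.
have df' : differentiable f (p 0) by rewrite p0.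
have dfp := differentiable_comp dp' df'.
apply: DeriveDef.
  have := @derivable_line _ _ _ (f \o g) v x 0; rewrite scale0r add0r => ->.
  by apply/derivable1_diffP; exact: dfp.
have := @derive_line _ _ _ (f \o g) v x 0; rewrite scale0r add0r => <-.
rewrite -[LHS]/('D_1 (f \o p) 0) (deriveE _ dfp) (diff_comp dp' df') /= -(deriveE _ dp').
have := @derive_line _ _ _ g v x 0; rewrite scale0r add0r => ->.
rewrite (derive_mx dgx) p0.
rewrite [X in 'd f _ X]row_sum_delta linear_sum; apply: eq_bigr => j _.
by rewrite linearZ /= mxE /partial (deriveE _ df).
Qed.

Lemma nbhs_all (T : topologicalType) (P : T -> Prop) (x : T) :
  (forall y, P y) -> \forall y \near x, P y.
Proof. by move=> H; near=> y; exact: H. Unshelve. all: by end_near. Qed.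

Lemma near_eq_for_continuous (T U : topologicalType) (f g : T -> U) (x : T) :
  {near x, f =1 g} -> {for x, continuous f} -> {for x, continuous g}.
Proof.
move=> fg cf; rewrite /prop_for /continuous_at -(nbhs_singleton fg).
exact: cvg_trans (near_eq_cvg fg) cf.
Qed.

(** * Calculus of C^k germs in Euclidean space *)

Section PointwiseCk.
Variables (R : realType) (n : nat).
Implicit Types (f g : 'rV[R]_n -> R) (x : 'rV[R]_n).

Local Notation e_ i := (delta_mx 0 i : 'rV[R]_n).

(* The pointwise form of [C_on]: it only depends on the germ of f at x, so it
   can be transported through charts without tracking open domains. *)
Fixpoint Ck_at (k : nat) f x : Prop :=
  (\forall y \near x, {for y, continuous f}) /\
  (if k is k'.+1 then
     forall i : 'I_n, (\forall y \near x, derivable f y (e_ i)) /\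
                      Ck_at k' (partial i f) x
   else True).

Lemma C_onP k (V : set 'rV[R]_n) f : open V ->
  C_on k V f <-> forall x, V x -> Ck_at k f x.
Proof.
move=> oV; elim: k f => [|k IH] f /=.
  split=> [[+ _] x Vx|H].
    rewrite continuous_open_subspace// => cf; split=> //.
    near=> y; apply: cf; apply/mem_set; near: y; exact: open_nbhs_nbhs.
  split=> //; rewrite continuous_open_subspace// => x /set_mem Vx.
  exact: nbhs_singleton (H x Vx).1.
split=> [[cf H] x Vx|H].
  split.
    move: cf; rewrite continuous_open_subspace// => cf.
    near=> y; apply: cf; apply/mem_set; near: y; exact: open_nbhs_nbhs.
  move=> i; have [df Cf] := H i; split; last exact: (IH _).1 Cf x Vx.
  near=> y; apply: df; near: y; exact: open_nbhs_nbhs.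
split.
  rewrite continuous_open_subspace// => x /set_mem Vx.
  exact: nbhs_singleton (H x Vx).1.
move=> i; split=> [x Vx|]; first exact: nbhs_singleton ((H x Vx).2 i).1.
by apply: (IH _).2 => x Vx; exact: ((H x Vx).2 i).2.
Unshelve. all: by end_near. Qed.

Lemma near_eq_partial f g x i : {near x, f =1 g} ->
  {near x, partial i f =1 partial i g}.
Proof.
move=> /near_join; apply: filterS => y fg; exact: near_eq_derive.
Qed.

Lemma near_eq_Ck k f g x : {near x, f =1 g} -> Ck_at k f x -> Ck_at k g x.
Proof.
elim: k f g => [|k IH] f g fg [cf H].
  split=> //; apply: filterS2 (near_join fg) cf => y; exact: near_eq_for_continuous.
split.
  apply: filterS2 (near_join fg) cf => y; exact: near_eq_for_continuous.
move=> i; have [df Cf] := H i; split.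
  apply: filterS2 (near_join fg) df => y; exact: near_eq_derivable.
exact: IH (near_eq_partial i fg) Cf.
Qed.

Lemma Ck_near k f x : Ck_at k f x -> \forall y \near x, Ck_at k f y.
Proof.
elim: k f => [|k IH] f [cf H].
  by have := near_join cf; apply: filterS => y.
have H' : \forall y \near x, forall i,
    (\forall z \near y, derivable f z (e_ i)) /\ Ck_at k (partial i f) y.
  apply: (filter_forall _ (fun i => filterI (near_join (H i).1) (IH _ (H i).2))).
by apply: filterS2 (near_join cf) H' => y.
Qed.

Lemma Ck_continuous k f x : Ck_at k f x -> {for x, continuous f}.
Proof. by case: k => [|k] [/nbhs_singleton]. Qed.

Lemma Ck_near_continuous k f x :
  Ck_at k f x -> \forall y \near x, {for y, continuous f}.
Proof. by case: k => [|k] []. Qed.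

Lemma CkW k f x : Ck_at k.+1 f x -> Ck_at k f x.
Proof.
elim: k f => [|k IH] f [cf H]; first by split.
by split=> // i; have [df Cf] := H i; split=> //; exact: IH.
Qed.

Lemma Ck_derivable k f x i : Ck_at k.+1 f x -> derivable f x (e_ i).
Proof. by move=> [_ /(_ i)[/nbhs_singleton]]. Qed.

Lemma Ck_differentiable k f x : Ck_at k.+1 f x -> differentiable f x.
Proof.
move=> [cf H]; apply: differentiable_partial => i; first by have [] := H i.
exact: Ck_continuous (H i).2.
Qed.

Lemma Ck_cst k (c : R) x : Ck_at k (cst c) x.
Proof.
elim: k c => [|k IH] c.
  by split=> //; apply: nbhs_all => y; exact: cst_continuous.
split; first by apply: nbhs_all => y; exact: cst_continuous.
move=> i; split; first by apply: nbhs_all => y; exact: derivable_cst.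
by rewrite (_ : partial i _ = cst 0) //; apply/funext => y; rewrite /partial derive_cst.
Qed.

Lemma CkD k f g x : Ck_at k f x -> Ck_at k g x -> Ck_at k (fun y => f y + g y) x.
Proof.
elim: k f g => [|k IH] f g [cf Hf] [cg Hg].
  by split=> //; apply: filterS2 cf cg => y; exact: continuousD.
split; first by apply: filterS2 cf cg => y; exact: continuousD.
move=> i; have [df Cf] := Hf i; have [dg Cg] := Hg i; split.
  by apply: filterS2 df dg => y; exact: derivableD.
apply: near_eq_Ck (IH _ _ Cf Cg).
by apply: filterS2 df dg => y dfy dgy; exact/esym/(deriveD dfy dgy).
Qed.

Lemma CkM k f g x : Ck_at k f x -> Ck_at k g x -> Ck_at k (fun y => f y * g y) x.
Proof.
elim: k f g => [|k IH] f g Hf Hg.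
  have [[cf _] [cg _]] := (Hf, Hg).
  by split=> //; apply: filterS2 cf cg => y; exact: continuousM.
have [[cf Cf] [cg Cg]] := (Hf, Hg).
split; first by apply: filterS2 cf cg => y; exact: continuousM.
move=> i; have [df Cfi] := Cf i; have [dg Cgi] := Cg i; split.
  by apply: filterS2 df dg => y; exact: derivableM.
apply: near_eq_Ck (CkD (IH _ _ (CkW Hf) Cgi) (IH _ _ (CkW Hg) Cfi)).
by apply: filterS2 df dg => y dfy dgy; exact/esym/(deriveM dfy dgy).
Qed.

Lemma Ck_sum k m (F : 'I_m -> 'rV[R]_n -> R) x :
  (forall i, Ck_at k (F i) x) -> Ck_at k (fun y => \sum_(i < m) F i y) x.
Proof.
elim: m F => [|m IH] F CF.
  apply: near_eq_Ck (Ck_cst k 0 x).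
  by apply: nbhs_all => y; rewrite big_ord0.
apply: near_eq_Ck (CkD (IH _ (fun i => CF (widen_ord (leqnSn m) i))) (CF ord_max)).
by apply: nbhs_all => y; rewrite big_ord_recr.
Qed.

Lemma Ck_coord k i x : Ck_at k (fun y : 'rV[R]_n => y 0 i) x.
Proof.
have d y : differentiable (fun y : 'rV[R]_n => y 0 i) y by exact: differentiable_coord.
case: k => [|k]; first by split=> //; apply: nbhs_all => y; exact: coord_continuous.
split; first by apply: nbhs_all => y; exact: coord_continuous.
move=> j; split; first by apply: nbhs_all => y; exact: diff_derivable.
rewrite (_ : partial j _ = cst ((i == j)%:R)); first exact: Ck_cst.
apply/funext => y; rewrite /partial -[y]add0r -(scale0r (e_ j)) -derive_line.
rewrite (_ : (fun s : R => _) = (fun s : R => (i == j)%:R *: s + y 0 i)); last first.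
  by apply/funext => s; rewrite !mxE mulrC.
by rewrite deriveD// derive_cst addr0 deriveZ//= derive_id [_ *: _]mulr1.
Qed.

End PointwiseCk.

Lemma continuous_rV (R : realType) (m : nat) (T : topologicalType)
    (g : T -> 'rV[R]_m) (y : T) :
  (forall j, {for y, continuous (fun z => g z 0 j)}) -> {for y, continuous g}.
Proof.
move=> cg; apply/cvgrPdist_le => e e0.
have : \forall z \near y, forall j, `|g y 0 j - g z 0 j| <= e.
  have cg' j : \forall z \near y, `|g y 0 j - g z 0 j| <= e.
    by have /cvgrPdist_le/(_ _ e0) := cg j.
  exact: (filter_forall _ cg').
apply: filterS => z Hz; apply: mx_norm_le; first exact: ltW.
by move=> j; rewrite !mxE.
Qed.

(** By the chain rule, near [x] each partial derivative of the composite is a sum of products to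
    which [CkM] and the induction hypothesis apply. *)
Lemma Ck_comp (R : realType) (m n k : nat) (f : 'rV[R]_m -> R)
    (g : 'rV[R]_n -> 'rV[R]_m) x :
  Ck_at k f (g x) -> (forall j, Ck_at k (fun y => g y 0 j) x) ->
  Ck_at k (f \o g) x.
Proof.
elim: k f => [|k IH] f Cf Cg.
  have cg : \forall y \near x, {for y, continuous g}.
    have cgj : \forall y \near x, forall j, {for y, continuous (fun z => g z 0 j)}.
      exact: (filter_forall _ (fun j => Ck_near_continuous (Cg j))).
    by apply: filterS cgj => y; exact: continuous_rV.
  split=> //.
  have cgx0 := nbhs_singleton cg.
  have cfg : \forall y \near x, {for g y, continuous f} by have := cgx0 _ Cf.1.
  by apply: filterS2 cg cfg => y; exact: continuous_comp.
have Cg' j := CkW (Cg j).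
have cg : \forall y \near x, {for y, continuous g}.
  have cgj : \forall y \near x, forall j, {for y, continuous (fun z => g z 0 j)}.
    exact: (filter_forall _ (fun j => Ck_near_continuous (Cg j))).
  by apply: filterS cgj => y; exact: continuous_rV.
have cgx0 := nbhs_singleton cg.
have df : \forall y \near x, differentiable f (g y).
  apply: (cgx0 [set z | differentiable f z]).
  by have := Ck_near Cf; apply: filterS => y; exact: Ck_differentiable.
split; first exact: Ck_near_continuous (IH f (CkW Cf) Cg').
move=> i.
have dgi : \forall y \near x, forall j, derivable (fun z => g z 0 j) y (delta_mx 0 i).
  exact: (filter_forall _ (fun j => ((Cg j).2 i).1)).
split.
  by apply: filterS2 df dgi => y dfy dgy; have [] := is_derive_comp_rV dfy dgy.
apply: (@near_eq_Ck _ _ _ (fun y => \sum_j partial i (fun z => g z 0 j) y * (partial j f \o g) y)).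
  by apply: filterS2 df dgi => y dfy dgy; have [_ <-] := is_derive_comp_rV dfy dgy.
apply: Ck_sum => j; apply: CkM; first exact: ((Cg j).2 i).2.
exact: IH (Cf.2 j).2 Cg'.
Qed.

(** * Flat functions *)

Section FlatFunction.
Variable R : realType.
Implicit Types (t y : R) (m : nat).

(* The family is closed under differentiation up to linear combinations, which
   is what makes the induction on the order of smoothness go through. *)
Definition flat m t : R := if 0 < t then t^-1 ^+ m * expR (- t^-1) else 0.

Lemma flat0 m t : t <= 0 -> flat m t = 0.
Proof. by rewrite /flat leNgt => /negbTE ->. Qed.

Lemma flat_gt0 m t : 0 < t -> 0 < flat m t.
Proof. by move=> t0; rewrite /flat t0 mulr_gt0 ?expR_gt0// exprn_gt0 ?invr_gt0. Qed.

Lemma flat_ge0 m t : 0 <= flat m t.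
Proof. by have [/flat0 ->|/flat_gt0 /ltW] := lerP t 0. Qed.

(** The left side is the power m+1 of y exp(- y / (m+1)), and y / (m+1) <= exp(y / (m+1)). *)
Lemma exprn_expRN_le m y : 0 <= y -> y ^+ m.+1 * expR (- y) <= m.+1%:R ^+ m.+1.
Proof.
move=> y0; rewrite expRN ler_pdivrMr ?expR_gt0//.
have -> : expR y = expR (y / m.+1%:R) ^+ m.+1.
  by rewrite -expRM_natl mulrC divfK// pnatr_eq0.
rewrite -exprMn lerXn2r ?nnegrE ?mulr_ge0 ?expR_ge0//.
rewrite mulrC -ler_pdivrMr// (le_trans _ (expR_ge1Dx _))// lerDr//.
Qed.

(** This is the previous bound at y = 1/t; the spare factor t is what makes the derivative at the
    origin vanish. *)
Lemma flat_le_linear m t : 0 <= t -> flat m t <= m.+1%:R ^+ m.+1 * t.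
Proof.
rewrite le_eqVlt => /predU1P[<-|t0]; first by rewrite flat0// mulr0.
rewrite /flat t0 -ler_pdivrMr//.
apply: le_trans (@exprn_expRN_le m t^-1 _); last by rewrite invr_ge0 ltW.
by rewrite exprSr mulrAC.
Qed.

Lemma is_derive_flat m t :
  is_derive t 1 (flat m) (- m%:R * flat m.+1 t + flat m.+2 t).
Proof.
have [t0|t0|<-] := ltgtP 0 t.
- have E : {near t, (fun s : R => s^-1 ^+ m * expR (- s^-1)) =1 flat m}.
    by near=> s; rewrite /flat ifT//; near: s; exact: lt_nbhsr.
  apply: (near_eq_is_derive E).
  have tn0 : t != 0 by rewrite gt_eqF.
  pose p := fun y : R => y ^+ m * expR (- y).
  have dV : is_derive t 1 (fun s : R => s^-1) (- t ^- 2).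
    apply: DeriveDef; first exact: (@derivableV _ _ id).
    by rewrite (@deriveV _ _ id)// derive_id [_ *: _]mulr1.
  have dp (y : R) : is_derive y 1 p (y ^+ m * - expR (- y) + expR (- y) * (m%:R * y ^+ m.-1)).
    have dX : is_derive y 1 (@GRing.exp R ^~ m) (m%:R * y ^+ m.-1).
      apply: DeriveDef; first exact: exprn_derivable.
      by rewrite exp_derive /GRing.scale /= mulr1.
    have dE : is_derive y 1 (expR \o -%R) (expR (- y) * -1) by exact: is_derive1_comp.
    apply: (is_derive_eq (is_deriveM dX dE)).
    by rewrite /GRing.scale /= mulrN1.
  have dc : is_derive t 1 (p \o (fun s : R => s^-1)) _ := is_derive1_comp (dp t^-1) dV.
  apply: (is_derive_eq dc); rewrite /flat t0.
  rewrite -exprVn; set y := t^-1; set e := expR _.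
  case: (m) => [|m']/=; rewrite !exprS; ring.
- rewrite !flat0 ?ltW// mulr0 addr0.
  apply: (@near_eq_is_derive _ _ _ (cst 0)).
  near=> s; rewrite flat0// ltW//; near: s; exact: lt_nbhsl.
- rewrite !flat0// mulr0 addr0.
  pose C : R := m.+2%:R ^+ m.+2.
  have C0 : 0 < C by rewrite exprn_gt0.
  suff H : h^-1 *: (flat m (h *: (1 : R) + 0) - flat m 0) @[h --> 0^'] --> (0 : R).
    by apply: DeriveDef; [apply/cvg_ex; exists 0|exact: cvg_lim H].
  apply/cvgrPdist_le => e e0; near=> h.
  rewrite sub0r normrN addr0 [_%:A]mulr1 (@flat0 m 0)// subr0.
  have [h0|h0] := lerP h 0; first by rewrite flat0// scaler0 normr0 ltW.
  (* The difference quotient at 0 is again in the family, so the linear bound sends it to 0. *)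
  have -> : h^-1 *: flat m h = flat m.+1 h.
    by rewrite /flat h0 /GRing.scale /= exprS mulrA.
  rewrite ger0_norm ?flat_ge0// (le_trans (flat_le_linear _ (ltW h0)))//.
  rewrite -/C mulrC -ler_pdivlMr// (le_trans (ler_norm h))//; near: h.
  by apply: dnbhs0_le; rewrite divr_gt0.
Unshelve. all: by end_near. Qed.

Lemma derivable_flat m t : derivable (flat m) t 1.
Proof. by have [] := is_derive_flat m t. Qed.

Lemma derive1_flat m t :
  (flat m)^`()%classic t = - m%:R * flat m.+1 t + flat m.+2 t.
Proof. by rewrite derive1E; have [] := is_derive_flat m t. Qed.

Lemma Ck_flat (n k m : nat) (q : 'rV[R]_n -> R) x :
  Ck_at k q x -> Ck_at k (flat m \o q) x.
Proof.
have cf (y : 'rV[R]_n) l : {for y, continuous q} -> {for y, continuous (flat l \o q)}.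
  move=> cq; apply: continuous_comp => //.
  exact/differentiable_continuous/derivable1_diffP/derivable_flat.
elim: k m => [|k IH] m [cq Hq].
  by split=> //; apply: filterS cq => y; exact: cf.
split; first by apply: filterS cq => y; exact: cf.
move=> i; have [dq Cq] := Hq i; split.
  apply: filterS dq => y dqy.
  by have [] := is_derive_comp1 (@derivable_flat m (q y)) dqy.
have Cq' : Ck_at k q x by apply: CkW; split.
have E : {near x, (fun y : 'rV[R]_n => (- m%:R * (flat m.+1 \o q) y + (flat m.+2 \o q) y) * partial i q y)
    =1 partial i (flat m \o q)}.
  apply: filterS dq => y dqy.
  have [_] := is_derive_comp1 (@derivable_flat m (q y)) dqy.
  by rewrite derive1_flat.
apply: (near_eq_Ck E).
apply: CkM Cq; apply: CkD (IH _ Cq').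
by apply: CkM (IH _ Cq'); exact: Ck_cst.
Qed.

End FlatFunction.

Lemma near_dist_le (R : realType) (T : topologicalType) (f : T -> R) (x : T) :
  {for x, continuous f} <->
  forall e, 0 < e -> \forall y \near x, `|f x - f y| <= e.
Proof.
split=> [cf e e0|H]; first by move/cvgrPdist_le : cf; apply.
by apply/cvgrPdist_le => e e0; exact: H.
Qed.

Lemma near_norm_lt (R : realType) (V : normedModType R) (x : V) (r : R) :
  `|x| < r -> \forall y \near x, `|y| < r.
Proof. by move=> xr; have /cvgr_lt := @norm_continuous _ _ x; apply. Qed.

(** * Hadamard's lemma *)

Section RadialIntegral.
Variables (R : realType) (n : nat).
Implicit Types (h : 'rV[R]_n -> R) (x : 'rV[R]_n).

Local Notation e_ i := (delta_mx 0 i : 'rV[R]_n).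
Local Notation mu := (@lebesgue_measure R).
Local Notation I01 := (`[0, 1]%classic : set R).

(* The partial derivatives of [radial m h] are the [radial m.+1 (partial i h)]:
   the power of t absorbs the chain-rule factor. *)
Definition radial m h x : R := \int[mu]_(t in I01) (t ^+ m * h (t *: x)).

Lemma norm_scale01 x (t : R) : t \in `[0, 1] -> `|t *: x| <= `|x|.
Proof.
rewrite in_itv/= => /andP[t0 t1].
by rewrite normrZ ger0_norm// ler_piMl.
Qed.

Lemma continuous_ray h x (t : R) : {for t *: x, continuous h} ->
  {for t, continuous (fun s : R => h (s *: x))}.
Proof.
move=> ch; apply: (@continuous_comp _ _ _ (fun s : R => s *: x) h).
  exact: scalel_continuous.
exact: ch.
Qed.

Lemma continuous_pow_ray m h x (t : R) : {for t *: x, continuous h} ->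
  {for t, continuous (fun s : R => s ^+ m * h (s *: x))}.
Proof.
move=> ch; apply: (@continuousM _ _ (fun s : R => s ^+ m) (fun s : R => h (s *: x))).
  exact: exprn_continuous.
exact: continuous_ray.
Qed.

Lemma radial_integrable m h x : (forall t : R, t \in `[0, 1] -> {for t *: x, continuous h}) ->
  mu.-integrable I01 (EFin \o (fun t : R => t ^+ m * h (t *: x))).
Proof.
move=> ch; apply: continuous_compact_integrable; first exact: segment_compact.
apply: continuous_in_subspaceT => t /set_mem t01.
exact/continuous_pow_ray/ch.
Qed.

Lemma Rintegral01_cst (c : R) : \int[mu]_(t in I01) c = c.
Proof. by rewrite Rintegral_cst//= lebesgue_measure_itv/= lte01 oppr0 adde0 mulr1. Qed.

Lemma Rintegral01_sum m (F : 'I_m -> R -> R) :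
  (forall i, mu.-integrable I01 (EFin \o F i)) ->
  \int[mu]_(t in I01) (\sum_i F i t) = \sum_i \int[mu]_(t in I01) F i t.
Proof.
move=> iF; rewrite /Rintegral; under eq_integral do rewrite -sumEFin.
rewrite (@integral_sum _ _ _ mu I01 _ _ (fun i t => (F i t)%:E))//.
by rewrite -sum_fine// => i _; apply: integrable_fin_num => //; exact: iF.
Qed.

(** Compactness of [0, 1] turns continuity at each point of the ray into closeness of the integrands
    uniformly in t. *)
Lemma radial_continuous m h (r : R) x :
  (forall y, `|y| < r -> {for y, continuous h}) -> `|x| < r ->
  {for x, continuous (radial m h)}.
Proof.
move=> ch xr; apply/near_dist_le => e e0.
have tl y : `|y| < r -> forall t : R, t \in `[0, 1] -> {for t *: y, continuous h}.
  by move=> yr t /(norm_scale01 y) ty; apply: ch; exact: le_lt_trans yr.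
have xr' := near_norm_lt xr.
have unif : \forall y \near x, I01 `<=` [set t : R | `|h (t *: x) - h (t *: y)| <= e].
  have /compact_near_coveringP/(_ _ (nbhs x) (fun y t => `|h (t *: x) - h (t *: y)| <= e)) :=
    @segment_compact R 0 1.
  apply => t /= t01; have htx := tl _ xr _ t01.
  have e20 : 0 < e / 2 by rewrite divr_gt0.
  have H := (near_dist_le _ _).1 htx _ e20.
  have Hs : \forall p \near (t, x), `|h (t *: x) - h (p.1 *: p.2)| <= e / 2.
    exact: (@scale_continuous _ _ (t, x) _ H).
  case: Hs => -[A B] /= [At Bx] AB; exists (A, B) => //= -[s y] /= [As By].
  (* Both h (s x) and h (s y) are compared with h (t x), since (s, x) and (s, y) lie in the same
     neighbourhood of (t, x). *)
  have h1 := AB (s, y) (conj As By).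
  have h2 := AB (s, x) (conj As (nbhs_singleton Bx)).
  rewrite /= in h1 h2.
  rewrite (splitr e) -(subrKA (h (t *: x))) (le_trans (ler_normD _ _))//.
  by rewrite lerD// distrC.
apply: filterS2 xr' unif => y yr Hy.
have ix := radial_integrable m (tl _ xr); have iy := radial_integrable m (tl _ yr).
rewrite /radial -RintegralB//.
have ixy : mu.-integrable I01 (EFin \o (fun t => t ^+ m * h (t *: x) - t ^+ m * h (t *: y))).
  by apply: (integrableB _ ix iy).
apply: (le_trans (le_normr_Rintegral _ ixy)) => //.
rewrite -[leRHS]Rintegral01_cst; apply: le_Rintegral => //.
- by have := integrable_norm ixy.
- by apply: continuous_compact_integrable; [exact: segment_compact|move=> ?; exact: cvg_cst].
move=> t /= t01; rewrite -mulrBr normrM normrX.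
have := t01; rewrite in_itv/= => /andP[t0 t1].
rewrite (le_trans _ (Hy t t01))// ler_piMl// exprn_ile1// ger0_norm//.
Qed.

(** Differentiation under the integral sign along the line through [x], dominated by a constant. *)
Lemma is_derive_radial m h (r : R) x i :
  (forall y, `|y| < r -> Ck_at 1 h y) -> `|x| < r ->
  is_derive x (e_ i) (radial m h) (radial m.+1 (partial i h) x).
Proof.
move=> Ch xr.
(* Half of the gap: for |s| < d and t in [0, 1] the points t (s e_i + x) stay in the closed ball of
   radius [rho], which is compact and inside the domain. *)
pose d := (r - `|x|) / 2; have d0 : 0 < d by rewrite divr_gt0// subr_gt0.
pose rho := `|x| + d; have rhor : rho < r by rewrite /rho /d; lra.
have ne1 : `|e_ i| <= 1.
  apply: mx_norm_le => // j; rewrite mxE eqxx /=.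
  by case: eqP => _; rewrite ?normr1 ?normr0.
have nb (s : R) : s \in `]- d, d[ -> `|s *: e_ i + x| <= rho.
  rewrite in_itv/= => sd; rewrite addrC (le_trans (ler_normD _ _))// lerD2l normrZ.
  rewrite (le_trans (ler_wpM2l (normr_ge0 _) ne1))// mulr1 ltW// ltr_norml//.
have nbt (s t : R) : s \in `]- d, d[ -> t \in `[0, 1] -> `|t *: (s *: e_ i + x)| <= rho.
  by move=> /nb sd t01; apply: le_trans sd; exact: norm_scale01.
pose K := [set y : 'rV[R]_n | `|y| <= rho].
have cK : compact K.
  apply: bounded_closed_compact.
    exists rho; split; first exact: num_real.
    by move=> M rM y /= yr; rewrite (le_trans yr)// ltW.
  apply: (@closed_comp _ _ (fun y : 'rV[R]_n => `|y|) [set z | z <= rho]).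
    by move=> y _; exact: norm_continuous.
  exact: closed_le.
(* The dominating constant is the maximum of the partial derivative on that ball. *)
have [M HM] : exists M, forall y, K y -> `|partial i h y| <= M.
  have K0 : K !=set0 by exists x; rewrite /K /= /rho lerDl ltW.
  have [|c _ Hc] := @compact_EVT_max _ R (fun y => `|partial i h y|) K K0 cK.
    apply: continuous_in_subspaceT => y /set_mem Ky.
    apply: continuous_comp; last exact: norm_continuous.
    exact: (@Ck_continuous _ _ 0%N) ((Ch _ (le_lt_trans Ky rhor)).2 i).2.
  by exists `|partial i h c| => y Ky; apply: Hc; exact/mem_set.
pose f (s t : R) := t ^+ m * h (t *: (s *: e_ i + x)).
have fray s t : f s t = t ^+ m * h (s *: (t *: e_ i) + t *: x).
  by rewrite /f scalerDr !scalerA (mulrC t s).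
have dh s t : s \in `]- d, d[ -> t \in `[0, 1] ->
    is_derive s 1 (f ^~ t) (t ^+ m.+1 * partial i h (t *: (s *: e_ i + x))).
  move=> sd t01; have Ky := nbt _ _ sd t01.
  have dfh := Ck_differentiable (Ch _ (le_lt_trans Ky rhor)).
  have E : t *: (s *: e_ i + x) = s *: (t *: e_ i) + t *: x.
    by rewrite scalerDr !scalerA (mulrC t s).
  have dl : derivable (fun s : R => h (s *: (t *: e_ i) + t *: x)) s 1.
    by apply/derivable_line; rewrite -E; exact: diff_derivable.
  have -> : f ^~ t = t ^+ m \*: (fun s : R => h (s *: (t *: e_ i) + t *: x)).
    by apply/funext => z; rewrite fray.
  apply: DeriveDef; first exact: derivableZ.
  rewrite deriveZ// derive_line -E (deriveE _ dfh) linearZ /= -(deriveE _ dfh).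
  by rewrite /GRing.scale /= exprSr mulrA.
have I0 : 0 \in `]- d, d[ by rewrite in_itv/= oppr_lt0 d0.
have fint s : `]- d, d[%classic s -> mu.-integrable I01 (EFin \o f s).
  move=> sd; apply: radial_integrable => t t01.
  exact: Ck_continuous (Ch _ (le_lt_trans (nbt _ _ sd t01) rhor)).
have derf s t : `]- d, d[%classic s -> I01 t -> derivable (f ^~ t) s 1.
  by move=> sd t01; have [] := dh s t sd t01.
have d1E s t : `]- d, d[%classic s -> I01 t ->
    partial1of2 f s t = t ^+ m.+1 * partial i h (t *: (s *: e_ i + x)).
  by move=> sd t01; rewrite partial1of2E; have [] := dh s t sd t01.
have M0 : 0 <= M by apply: (le_trans _ (HM x _)) => //; rewrite /K /= /rho lerDl ltW.
have iM : mu.-integrable I01 (EFin \o cst M).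
  by apply: continuous_compact_integrable; [exact: segment_compact|move=> ?; exact: cvg_cst].
have bnd s t : `]- d, d[%classic s -> I01 t -> `|partial1of2 f s t| <= cst M t.
  move=> sd t01; rewrite d1E// normrM normrX /=.
  have := t01; rewrite /= in_itv/= => /andP[t0 t1].
  apply: le_trans (HM _ (nbt _ _ sd t01)).
  by rewrite ler_piMl// exprn_ile1// ger0_norm.
have mI : measurable (I01 : set (measurableTypeR R)) by exact: measurable_itv.
have dF := @derivable_under_integral R _ _ mu f I01 mI 0 (- d) d I0 fint derf (cst M) (fun=> M0) iM bnd.
have FE := @differentiation_under_integral R _ _ mu f I01 mI 0 (- d) d I0 fint derf (cst M) (fun=> M0) iM bnd.
apply: DeriveDef.
  have := @derivable_line _ _ _ (radial m h) (e_ i) x 0; rewrite scale0r add0r => ->.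
  exact: dF.
have := @derive_line _ _ _ (radial m h) (e_ i) x 0; rewrite scale0r add0r => <-.
rewrite -derive1E FE; apply: eq_Rintegral => t /set_mem t01.
by rewrite d1E// scale0r add0r.
Qed.

(** All orders are assumed of [h] because each step of the induction replaces it by a partial
    derivative. *)
Lemma Ck_radial k m h (r : R) : (forall l x, `|x| < r -> Ck_at l h x) ->
  forall x, `|x| < r -> Ck_at k (radial m h) x.
Proof.
elim: k m h => [|k IH] m h Ch x xr.
all: have xr' := near_norm_lt xr.
all: have cr : \forall y \near x, {for y, continuous (radial m h)}
  by apply: filterS xr' => y; apply: radial_continuous => z /(Ch 0%N); exact: Ck_continuous.
  by split.
split=> // i.
have di : \forall y \near x, is_derive y (e_ i) (radial m h) (radial m.+1 (partial i h) y).
  by apply: filterS xr' => y; apply: is_derive_radial => z /(Ch 1%N).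
split; first by apply: filterS di => y [].
apply: (@near_eq_Ck _ _ _ (radial m.+1 (partial i h))).
  by apply: filterS di => y [].
by apply: IH xr => l y /(Ch l.+1)[_ /(_ i)[]].
Qed.

(** The fundamental theorem of calculus for t -> h (t x) on [0, 1], whose derivative is linear in
    the coordinates of x. *)
Lemma hadamard h (r : R) : (forall l x, `|x| < r -> Ck_at l h x) ->
  forall x, `|x| < r -> h x = h 0 + \sum_i x 0 i * radial 0 (partial i h) x.
Proof.
move=> Ch x xr.
have tl (t : R) : t \in `[0, 1] -> `|t *: x| < r.
  by move=> /(norm_scale01 x) tx; exact: le_lt_trans xr.
have ci i (t : R) : t \in `[0, 1] -> {for t *: x, continuous (partial i h)}.
  by move=> /tl /(Ch 1%N)[_ /(_ i)[_]]; exact: (@Ck_continuous _ _ 0%N).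
(* The factor [t ^+ 0] is there so that the integral matches [radial 0]. *)
pose g (t : R) := \sum_i x 0 i * (t ^+ 0 * partial i h (t *: x)).
have dg (t : R) : t \in `[0, 1] -> is_derive t 1 (fun s : R => h (s *: x)) (g t).
  move=> t01.
  have dh := Ck_differentiable (Ch 1%N _ (tl t t01)).
  have E s : h (s *: x) = h (s *: x + 0) by rewrite addr0.
  under eq_fun do rewrite E.
  apply: DeriveDef; first by apply/derivable_line; rewrite addr0; exact: diff_derivable.
  rewrite derive_line addr0 (deriveE _ dh).
  have -> : 'd h (t *: x) x = 'd h (t *: x) (\sum_j x 0 j *: e_ j) by rewrite -row_sum_delta.
  rewrite linear_sum.
  by apply: eq_bigr => i _; rewrite linearZ /= mul1r /partial (deriveE _ dh).
have cg (t : R) : t \in `[0, 1] -> {for t, continuous g}.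
  move=> t01; rewrite /g.
  have -> : (fun t : R => \sum_i x 0 i * (t ^+ 0 * partial i h (t *: x))) =
    \sum_i (fun t : R => x 0 i * (t ^+ 0 * partial i h (t *: x))).
    by apply/funext => s; rewrite fct_sumE.
  apply: (big_ind (fun f : R -> R => {for t, continuous f})).
  - exact: cst_continuous.
  - by move=> f1 f2; exact: continuousD.
  - move=> i _; apply: (@continuousM _ _ (cst (x 0 i)) (fun t : R => t ^+ 0 * partial i h (t *: x))).
      exact: cst_continuous.
    by apply: continuous_pow_ray; exact: ci.
have ch (t : R) : t \in `[0, 1] -> {for t, continuous (fun s : R => h (s *: x))}.
  by move=> t01; apply: continuous_ray; exact: Ck_continuous (Ch 0%N _ (tl t t01)).
have := @continuous_FTC2 R g (fun s : R => h (s *: x)) 0 1 ltr01.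
rewrite scale1r scale0r => FTC.
have int : \int[mu]_(t in I01) g t = h x - h 0.
  rewrite /Rintegral FTC//.
  - by apply: continuous_in_subspaceT => t /set_mem; exact: cg.
  - split.
    + by move=> t /subset_itv_oo_cc t01; have [] := dg t t01.
    + by apply: cvg_at_right_filter; apply: ch; rewrite in_itv/= lexx ler01.
    + by apply: cvg_at_left_filter; apply: ch; rewrite in_itv/= lexx ler01.
  - by move=> t /subset_itv_oo_cc t01; rewrite derive1E; have [] := dg t t01.
rewrite -[LHS](subrK (h 0)) addrC -int /g; congr (_ + _).
have ip i := radial_integrable 0 (ci i).
have mI : measurable (I01 : set (measurableTypeR R)) by exact: measurable_itv.
rewrite Rintegral01_sum => [|i]; last first.
  by have := @integrableZl _ _ _ mu _ mI (x 0 i) _ (ip i).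
by apply: eq_bigr => i _; exact: RintegralZl (ip i).
Qed.

End RadialIntegral.

(** * Smooth functions on manifolds *)

Section Charts.
Variable R : realType.

Lemma near_open (T : topologicalType) (A : set T) (x : T) :
  open A -> A x -> \forall y \near x, A y.
Proof. by move=> oA Ax; exact: open_nbhs_nbhs. Qed.

Lemma open_near (T : topologicalType) (A : set T) :
  (forall x, A x -> \forall y \near x, A y) -> open A.
Proof. by move=> H; rewrite openE => x Ax; exact: H. Qed.

Section OneChart.
Variables (T : topologicalType) (n : nat) (c : chart R T n).
Hypothesis hc : chart_axiom c.

Lemma coordK x : chart_dom c x -> param c (coord c x) = x.
Proof. by case: hc => _ _ + _ _; apply. Qed.

Lemma near_chart_dom x : chart_dom c x -> \forall y \near x, chart_dom c y.
Proof. by case: hc => oD _ _ _ _; exact: near_open. Qed.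

Lemma coord_continuous_at x : chart_dom c x -> {for x, continuous (coord c)}.
Proof.
case: hc => oD _ _ + _ Dx; rewrite continuous_open_subspace// => H.
by apply: H; exact/mem_set.
Qed.

Lemma param_continuous_at x : chart_dom c x -> {for coord c x, continuous (param c)}.
Proof.
case: hc => _ oI _ _ + Dx; rewrite continuous_open_subspace// => H.
by apply: H; apply/mem_set; exists x.
Qed.

Lemma near_coord (P : T -> Prop) x : chart_dom c x -> (\forall y \near x, P y) ->
  \forall v \near coord c x,
    [/\ chart_dom c (param c v), coord c (param c v) = v & P (param c v)].
Proof.
move=> Dx Px; have [_ oI _ _ _] := hc.
have H1 : \forall v \near coord c x, (coord c @` chart_dom c) v.
  by apply: near_open => //; exists x.
have H2 : \forall v \near coord c x, P (param c v).
  have Px' : nbhs (param c (coord c x)) P by rewrite coordK.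
  exact: param_continuous_at Dx P Px'.
by apply: filterS2 H1 H2 => v [z Dz <-]; rewrite coordK// => Pz; split.
Qed.

Lemma open_coord_image (W : set T) : open W -> W `<=` chart_dom c ->
  open (coord c @` W).
Proof.
move=> oW WD; apply: open_near => _ [x Wx <-].
have := near_coord (WD _ Wx) (near_open oW Wx).
by apply: filterS => v [Dv vE Wv]; exists (param c v).
Qed.

End OneChart.

Lemma continuous_lsubmx (m n : nat) : continuous (@lsubmx R 1 m n).
Proof. by move=> v; apply: differentiable_continuous; exact: differentiable_lsubmx. Qed.

Lemma continuous_rsubmx (m n : nat) : continuous (@rsubmx R 1 m n).
Proof. by move=> v; apply: differentiable_continuous; exact: differentiable_rsubmx. Qed.

(** [prod_space] is a charted space without the manifold axioms, so its charts are checked here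
    before smoothness of a local trivialization is read in them. *)
Lemma prod_chart_axiom (S T : topologicalType) (m n : nat)
    (c : chart R S m) (d : chart R T n) :
  chart_axiom c -> chart_axiom d -> chart_axiom (prod_chart c d).
Proof.
move=> hc hd; have [oc oic _ _ _] := hc; have [od oid _ _ _] := hd.
have oX : open (chart_dom c `*` chart_dom d).
  apply: open_near => -[x y] [/= Dx Dy].
  by exists (chart_dom c, chart_dom d) => //; split; exact: near_open.
have IE : coord (prod_chart c d) @` chart_dom (prod_chart c d) =
    [set v | (coord c @` chart_dom c) (lsubmx v) /\ (coord d @` chart_dom d) (rsubmx v)].
  apply/seteqP; split=> [_ [[x y] [/= Dx Dy] <-]|v [[x Dx xv] [y Dy yv]]] /=.
    by rewrite row_mxKl row_mxKr; split; [exists x|exists y].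
  by exists (x, y) => //=; rewrite xv yv hsubmxK.
have oI : open (coord (prod_chart c d) @` chart_dom (prod_chart c d)).
  rewrite IE; apply: open_near => v [Lv Rv].
  have h1 : \forall w \near v, (coord c @` chart_dom c) (lsubmx w).
    exact: continuous_lsubmx (near_open oic Lv).
  have h2 : \forall w \near v, (coord d @` chart_dom d) (rsubmx w).
    exact: continuous_rsubmx (near_open oid Rv).
  by apply: filterS2 h1 h2 => w.
split=> //=.
- by move=> [x y] [/= Dx Dy]; rewrite row_mxKl row_mxKr !coordK.
- rewrite continuous_open_subspace// => -[x y] /set_mem[/= Dx Dy].
  apply: continuous_rV => j; case: (split_ordP j) => k ->.
    apply: (@near_eq_for_continuous _ _ (fun z : (S * T)%type => coord c z.1 0 k)).
      by apply: nbhs_all => z; rewrite row_mxEl.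
    apply: (@continuous_comp _ _ _ (fun z : S * T => coord c z.1) (fun v => v 0 k)).
      apply: (@continuous_comp _ _ _ fst (coord c)); first exact: cvg_fst.
      exact: coord_continuous_at.
    exact: coord_continuous.
  apply: (@near_eq_for_continuous _ _ (fun z : (S * T)%type => coord d z.2 0 k)).
    by apply: nbhs_all => z; rewrite row_mxEr.
  apply: (@continuous_comp _ _ _ (fun z : S * T => coord d z.2) (fun v => v 0 k)).
    apply: (@continuous_comp _ _ _ snd (coord d)); first exact: cvg_snd.
    exact: coord_continuous_at.
  exact: coord_continuous.
- rewrite continuous_open_subspace// => v /set_mem.
  rewrite -[_ `*` _]/(chart_dom (prod_chart c d)) -[image _ _]/(coord (prod_chart c d) @` _).
  rewrite IE => -[[x Dx xv] [y Dy yv]].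
  have h1 : {for v, continuous (param c \o @lsubmx R 1 m n)}.
    apply: continuous_comp; first exact: continuous_lsubmx.
    by rewrite -xv; exact: param_continuous_at.
  have h2 : {for v, continuous (param d \o @rsubmx R 1 m n)}.
    apply: continuous_comp; first exact: continuous_rsubmx.
    by rewrite -yv; exact: param_continuous_at.
  exact: cvg_pair h1 h2.
Qed.

Lemma smooth_map_on_Ck (M N : chartedSpace R) (A : set M) (f : M -> N) c d x :
  chart_axiom c -> chart_axiom d -> atlas (c := M) c -> atlas (c := N) d ->
  open A -> smooth_map_on A f -> chart_dom c x -> A x -> chart_dom d (f x) ->
  forall k j, Ck_at k (fun v => coord d (f (param c v)) 0 j) (coord c x).
Proof.
move=> hc hd ac ad oA [cf sf] Dx Ax Dfx k j.
have := sf c d ac ad j k.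
rewrite C_onP; first by apply; exists x.
apply: open_coord_image => //; last by move=> z [[]].
apply: open_near => z [[Dz Az] Dfz].
have cfz : {for z, continuous f}.
  by move: cf; rewrite continuous_open_subspace//; apply; exact/mem_set.
have h1 := near_chart_dom hc Dz; have h2 := near_open oA Az.
have h3 : \forall y \near z, chart_dom d (f y) := cfz _ (near_chart_dom hd Dfz).
by near=> y; split; [split|]; near: y.
Unshelve. all: by end_near. Qed.

Lemma Ck_comp_smooth_map_on (M N : chartedSpace R) (A : set M) (f : M -> N)
    (g : N -> R) c d x k :
  chart_axiom c -> chart_axiom d -> atlas (c := M) c -> atlas (c := N) d ->
  open A -> smooth_map_on A f -> chart_dom c x -> A x -> chart_dom d (f x) ->
  Ck_at k (g \o param d) (coord d (f x)) -> Ck_at k (g \o f \o param c) (coord c x).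
Proof.
move=> hc hd ac ad oA sf Dx Ax Dfx Cg.
have cfx : {for x, continuous f}.
  by move: sf => [+ _]; rewrite continuous_open_subspace//; apply; exact/mem_set.
have h : \forall y \near x, chart_dom d (f y) := cfx _ (near_chart_dom hd Dfx).
apply: (@near_eq_Ck _ _ _ ((g \o param d) \o (fun v => coord d (f (param c v))))).
  have := near_coord hc Dx h.
  by apply: filterS => v [_ _ Dfv] /=; rewrite coordK.
apply: Ck_comp; first by rewrite coordK.
exact: (smooth_map_on_Ck hc hd ac ad oA sf Dx Ax Dfx).
Qed.

End Charts.

Section SmoothFunctions.
Variables (R : realType) (M : smoothManifold R).
Implicit Types (f g : M -> R) (x : M).

(** A single chart is enough by compatibility: this existential form is easy to establish, and
    [smooth_nearP] gives the universal one. *)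
Definition smooth_near f x : Prop := exists c,
  [/\ atlas (c := M) c, chart_dom c x & forall k, Ck_at k (f \o param c) (coord c x)].

Lemma smooth_nearP f x d : smooth_near f x -> atlas (c := M) d -> chart_dom d x ->
  forall k, Ck_at k (f \o param d) (coord d x).
Proof.
move=> [c [ac Dc Cf]] ad Dd k.
have [hc hd] := (atlas_charts ac, atlas_charts ad).
apply: (@near_eq_Ck _ _ _ ((f \o param c) \o (fun v => coord c (param d v)))).
  have := near_coord hd Dd (near_chart_dom hc Dc).
  by apply: filterS => v [_ _ Dv] /=; rewrite coordK.
apply: Ck_comp; first by rewrite coordK.
move=> j; have := atlas_compat ad ac j k.
rewrite C_onP; first by apply; exists x.
apply: (open_coord_image hd); last by move=> z [].
have [od _ _ _ _] := hd; have [oc _ _ _ _] := hc.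
exact: (@openI (M : topologicalType) _ _ od oc).
Qed.

Lemma smooth_functionP f : smooth_function f <-> forall x, smooth_near f x.
Proof.
split=> [sf x|sf c ac k].
  have [c [ac Dx]] := atlas_cover x; exists c; split=> // k.
  have [_ oI _ _ _] := atlas_charts ac.
  by have := sf c ac k; rewrite C_onP//; apply; exists x.
have [_ oI _ _ _] := atlas_charts ac.
by rewrite C_onP// => _ [x Dx <-]; exact: smooth_nearP.
Qed.

Lemma near_eq_smooth f g x : {near x, f =1 g} -> smooth_near f x -> smooth_near g x.
Proof.
move=> fg [c [ac Dx Cf]]; exists c; split=> // k; apply: near_eq_Ck (Cf k).
have := near_coord (atlas_charts ac) Dx fg.
by apply: filterS => v [].
Qed.

Lemma smooth_near_continuous f x : smooth_near f x -> {for x, continuous f}.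
Proof.
move=> [c [ac Dx Cf]]; have hc := atlas_charts ac.
apply: (@near_eq_for_continuous _ _ ((f \o param c) \o coord c)).
  by have := near_chart_dom hc Dx; apply: filterS => z Dz /=; rewrite coordK.
apply: continuous_comp; first exact: coord_continuous_at.
exact: Ck_continuous (Cf 0%N).
Qed.

Lemma smooth_near_cst (a : R) x : smooth_near (fun=> a) x.
Proof. by have [c [ac Dx]] := atlas_cover x; exists c; split=> // k; exact: Ck_cst. Qed.

Lemma smooth_nearD f g x : smooth_near f x -> smooth_near g x ->
  smooth_near (fun z => f z + g z) x.
Proof.
move=> [c [ac Dx Cf]] sg; exists c; split=> // k.
exact: CkD (Cf k) (smooth_nearP sg ac Dx k).
Qed.

Lemma smooth_nearM f g x : smooth_near f x -> smooth_near g x ->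
  smooth_near (fun z => f z * g z) x.
Proof.
move=> [c [ac Dx Cf]] sg; exists c; split=> // k.
exact: CkM (Cf k) (smooth_nearP sg ac Dx k).
Qed.

Lemma smooth_near_flat m f x : smooth_near f x -> smooth_near (fun z => flat m (f z)) x.
Proof.
by move=> [c [ac Dx Cf]]; exists c; split=> // k; exact: Ck_flat (Cf k).
Qed.

End SmoothFunctions.

Lemma continuous_norm_sub (R : realType) (V : normedModType R) (a : V) :
  continuous (fun v : V => `|v - a|).
Proof. by move=> v; apply: cvg_norm; apply: cvgB; [exact: cvg_id|exact: cvg_cst]. Qed.

(** * Extension by zero of locally smooth functions *)

Section BumpFunctions.
Variables (R : realType) (M : smoothManifold R).
Implicit Types (f g : M -> R) (x : M).

Lemma smooth_near_coord c x (F : 'rV[R]_(dim M) -> R) :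
  atlas (c := M) c -> chart_dom c x -> (forall k, Ck_at k F (coord c x)) ->
  smooth_near (F \o coord c) x.
Proof.
move=> ac Dx CF; exists c; split=> // k; apply: near_eq_Ck (CF k).
have hc := atlas_charts ac.
have := near_coord hc Dx (near_chart_dom hc Dx).
by apply: filterS => v [_ vE _] /=; rewrite vE.
Qed.

Lemma near_ball_image (n : nat) (T : topologicalType) (c : chart R T n) (U : set T) (x : T) :
  chart_axiom c -> chart_dom c x -> open U -> U x ->
  exists2 r : R, 0 < r & forall v, `|v - coord c x| < r ->
    [/\ chart_dom c (param c v), coord c (param c v) = v & U (param c v)].
Proof.
move=> hc Dx oU Ux; have := near_coord hc Dx (near_open oU Ux).
by move=> /nbhs_normP[r /= r0 Hr]; exists r => // v vr; apply: Hr; rewrite /ball_/= distrC.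
Qed.

(** The last clause is the form in which cutoffs are used: [f] may be arbitrary off [U]. It holds
    because [chi] vanishes off a closed set contained in [U]. *)
Lemma bump x (U : set M) : open U -> U x -> exists chi : M -> R,
  [/\ chi x = 1, forall z, 0 <= chi z, forall z, ~ U z -> chi z = 0 &
      forall f, (forall z, U z -> smooth_near f z) ->
        smooth_function (fun z => chi z * f z)].
Proof.
move=> oU Ux; have [c [ac Dx]] := atlas_cover x; have hc := atlas_charts ac.
have [r r0 Hr] := near_ball_image hc Dx oU Ux.
pose rho := r / 2; have rho0 : 0 < rho by rewrite divr_gt0.
have rr : rho < r by rewrite /rho; lra.
pose v0 := coord c x.
pose B := [set v : 'rV[R]_(dim M) | `|v - v0| <= rho].
have BP v : B v -> [/\ chart_dom c (param c v), coord c (param c v) = v & U (param c v)].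
  by move=> Bv; apply: Hr; exact: le_lt_trans rr.
have cB : compact B.
  apply: bounded_closed_compact.
    exists (rho + `|v0|); split; first exact: num_real.
    move=> A rA v /= Bv; rewrite -(subrK v0 v) (le_trans (ler_normD _ _))//.
    by rewrite (le_trans _ (ltW rA))// lerD2r.
  have cn : continuous (fun v : 'rV[R]_(dim M) => `|v - v0|).
    exact: continuous_norm_sub.
  apply: (@closed_comp _ _ (fun v : 'rV[R]_(dim M) => `|v - v0|) [set z | z <= rho]).
    by move=> v _; exact: cn.
  exact: closed_le.
(* As a compact subset of a Hausdorff space, [K] is closed in all of M and not only in the chart. *)
pose K : set M := param c @` B.
have clK : closed K.
  apply: compact_closed; first exact: manifold_hausdorff.
  apply: continuous_compact => //.
  apply: continuous_in_subspaceT => v /set_mem /BP[Dv vE _].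
  by have := param_continuous_at hc Dv; rewrite vE.
(* Sums of squares are smooth while the sup norm is not; [q] is positive only inside the Euclidean
   ball, which the sup-norm ball [B] contains. *)
pose q (v : 'rV[R]_(dim M)) := rho ^+ 2 + \sum_i (-1 * ((v 0 i - v0 0 i) * (v 0 i - v0 0 i))).
have Cq k v : Ck_at k q v.
  apply: CkD; first exact: Ck_cst.
  apply: Ck_sum => i; apply: CkM; first exact: Ck_cst.
  by apply: CkM; apply: CkD; [exact: Ck_coord|exact: Ck_cst|exact: Ck_coord|exact: Ck_cst].
pose w (v : 'rV[R]_(dim M)) := (flat 0 (rho ^+ 2))^-1 * flat 0 (q v).
have Cw k v : Ck_at k w v.
  by apply: CkM; [exact: Ck_cst|exact: Ck_flat].
have fr : 0 < flat 0 (rho ^+ 2) by rewrite flat_gt0// exprn_gt0.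
have w0 v : 0 <= w v by rewrite mulr_ge0 ?invr_ge0 ?(ltW fr)// flat_ge0.
have wB v : ~ B v -> w v = 0.
  move=> nBv; suff qv : q v <= 0 by rewrite /w (flat0 0 qv) mulr0.
  have [i] : exists i, rho < `|(v - v0) 0 i|.
    apply: contrapT => H; apply: nBv; rewrite /B /=; apply: mx_norm_le; first exact: ltW.
    by move=> i; rewrite leNgt; apply/negP => h; apply: H; exists i.
  rewrite !mxE => hi; rewrite /q -mulr_sumr mulN1r subr_le0.
  rewrite (bigD1 i)//= -[leLHS]addr0 lerD//.
    by rewrite -expr2 -[leRHS]real_normK ?num_real// ler_sqr ?nnegrE ?(ltW rho0)// ltW.
  by apply: sumr_ge0 => j _; rewrite -expr2 sqr_ge0.
(* Cutting off at [K] instead of the chart domain changes no value in the chart, because [w] is 0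
   off [B]. *)
pose chi z := if pselect (K z) then w (coord c z) else 0.
have chiK z : chart_dom c z -> chi z = w (coord c z).
  move=> Dz; rewrite /chi; case: pselect => // nK; rewrite wB// => Bz; apply: nK.
  by exists (coord c z) => //; rewrite coordK.
have KU z : K z -> chart_dom c z /\ U z by move=> [v /BP[Dv _ Uv] <-].
have chi_nK z : ~ K z -> chi z = 0 by rewrite /chi; case: pselect.
exists chi; split.
- rewrite chiK// /w /q big1 ?addr0 ?mulVf ?gt_eqF// => i _.
  by rewrite subrr mulr0 mulr0.
- by move=> z; rewrite /chi; case: pselect => // Kz; exact: w0.
- by move=> z nUz; apply: chi_nK => /KU[].
move=> f sf; apply/smooth_functionP => z.
have [Kz|nKz] := pselect (K z); last first.
  apply: (@near_eq_smooth _ _ (fun=> 0)); last exact: smooth_near_cst.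
  have oK : open (~` K) by exact: closed_openC.
  by have := near_open oK nKz; apply: filterS => y nKy; rewrite chi_nK// mul0r.
have [Dz Uz] := KU _ Kz.
apply: smooth_nearM; last exact: sf.
apply: (@near_eq_smooth _ _ (w \o coord c)).
  by have := near_chart_dom hc Dz; apply: filterS => y Dy; rewrite chiK.
exact: smooth_near_coord.
Qed.

End BumpFunctions.

(** * First-order condition at a maximum, for derivations *)

Section Derivations.
Variables (R : realType) (M : smoothManifold R) (x : M) (v : (M -> R) -> R).
Hypothesis tv : tangent_vector x v.
Implicit Types f g : M -> R.

Lemma smooth_cst (a : R) : smooth_function (fun _ : M => a).
Proof. by apply/smooth_functionP => z; exact: smooth_near_cst. Qed.

Lemma smoothD f g : smooth_function f -> smooth_function g ->
  smooth_function (fun z => f z + g z).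
Proof. by rewrite !smooth_functionP => sf sg z; exact: smooth_nearD. Qed.

Lemma smoothM f g : smooth_function f -> smooth_function g ->
  smooth_function (fun z => f z * g z).
Proof. by rewrite !smooth_functionP => sf sg z; exact: smooth_nearM. Qed.

Lemma tangentM f g : smooth_function f -> smooth_function g ->
  v (fun z => f z * g z) = f x * v g + v f * g x.
Proof. by case: tv => _; apply. Qed.

Lemma tangent_cst (a : R) : v (fun=> a) = 0.
Proof.
have v1 : v (fun=> 1) = 0.
  have := tangentM (smooth_cst 1) (smooth_cst 1).
  under [X in v X]eq_fun do rewrite mulr1.
  by rewrite mulr1 mul1r => ?; lra.
have v0 : v (fun=> 0) = 0.
  have := tv.1 1 _ _ (smooth_cst 0) (smooth_cst 0).
  under [X in v X]eq_fun do rewrite mulr0 addr0.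
  by rewrite mul1r => ?; lra.
have := tv.1 a _ _ (smooth_cst 1) (smooth_cst 0).
under [X in v X]eq_fun do rewrite mulr1 addr0.
by rewrite v1 v0 mulr0 addr0.
Qed.

Lemma tangentD f g : smooth_function f -> smooth_function g ->
  v (fun z => f z + g z) = v f + v g.
Proof.
move=> sf sg; have := tv.1 1 _ _ sf sg.
by under [X in v X]eq_fun do rewrite mul1r; rewrite mul1r.
Qed.

Lemma tangentZ (a : R) f : smooth_function f -> v (fun z => a * f z) = a * v f.
Proof.
by move=> sf; rewrite tangentM ?tangent_cst ?mul0r ?addr0//; exact: smooth_cst.
Qed.

Lemma smooth_sum n (F : 'I_n -> M -> R) :
  (forall i, smooth_function (F i)) -> smooth_function (fun z => \sum_i F i z).
Proof.
elim: n F => [|n IH] F sF.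
  by under eq_fun do rewrite big_ord0; exact: smooth_cst.
under eq_fun do rewrite big_ord_recr /=.
by apply: smoothD (sF _); exact: IH.
Qed.

Lemma tangent_sum n (F : 'I_n -> M -> R) : (forall i, smooth_function (F i)) ->
  v (fun z => \sum_i F i z) = \sum_i v (F i).
Proof.
elim: n F => [|n IH] F sF.
  by under eq_fun do rewrite big_ord0; rewrite big_ord0 tangent_cst.
under eq_fun do rewrite big_ord_recr /=.
rewrite tangentD ?IH ?big_ord_recr//.
exact: smooth_sum.
Qed.

(* By Hadamard's lemma, f = sum_i x_i G_i near x with x_i(x) = G_i(x) = 0. Only
   chi x = 1 is needed of the bump function chi that makes the factors global:
   v (chi^2 f) = v f because f x = 0. *)
Lemma tangent_max f : smooth_function f -> f x = 0 -> (forall z, f z <= 0) ->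
  v f = 0.
Proof.
move=> sf fx0 f0; have [c [ac Dx]] := atlas_cover x; have hc := atlas_charts ac.
have [r r0 Hr] := near_ball_image hc Dx openT (I : [set: M] x).
pose v0 := coord c x.
pose h (w : 'rV[R]_(dim M)) := f (param c (w + v0)).
have Cshift k (F : 'rV[R]_(dim M) -> R) (w s : 'rV[R]_(dim M)) :
    Ck_at k F (w + s) -> Ck_at k (F \o (fun u => u + s)) w.
  move=> CF; apply: Ck_comp => // j.
  apply: (@near_eq_Ck _ _ _ (fun u : 'rV[R]_(dim M) => u 0 j + s 0 j)).
    by apply: nbhs_all => u; rewrite mxE.
  by apply: CkD; [exact: Ck_coord|exact: Ck_cst].
have Ch l w : `|w| < r -> Ck_at l h w.
  move=> wr; apply: (@Cshift l (f \o param c)).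
  have [|Dw wE _] := Hr (w + v0); first by rewrite addrK.
  have /smooth_functionP/(_ (param c (w + v0))) sfw := sf.
  by have := smooth_nearP sfw ac Dw l; rewrite wE.
have h0 : h 0 = 0 by rewrite /h add0r coordK.
pose G i := radial 0 (partial i h).
have CG l i w : `|w| < r -> Ck_at l (G i) w.
  by move=> wr; apply: Ck_radial wr => l' y /(Ch l'.+1)[_ /(_ i)[]].
(* Along each axis, h has an interior maximum at 0. *)
have dh0 i : partial i h 0 = 0.
  have n1 : `|delta_mx 0 i : 'rV[R]_(dim M)| <= 1.
    apply: mx_norm_le => // j; rewrite mxE eqxx /=.
    by case: eqP => _; rewrite ?normr1 ?normr0.
  have := @derive1_at_max R (fun s => h (s *: delta_mx 0 i + 0)) (- r) r 0.
  rewrite scale0r add0r h0 => H.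
  have : is_derive (0 : R) 1 (fun s => h (s *: delta_mx 0 i + 0)) 0.
    apply: H.
    - by rewrite ge0_cp ?ltW.
    - move=> t; rewrite in_itv/= -ltr_norml => tr.
      apply/derivable_line; rewrite addr0; apply: Ck_derivable (Ch 1%N _ _).
      by rewrite normrZ (le_lt_trans _ tr)// ler_piMr.
    - by rewrite in_itv/= oppr_lt0 r0.
    - by move=> t _; exact: f0.
  by move=> [_]; rewrite derive_line scale0r add0r.
pose U := [set z : M | chart_dom c z /\ `|coord c z - v0| < r].
have oU : open U.
  apply: open_near => z [Dz zr].
  have cn : {for z, continuous (fun y => coord c y - v0)}.
    apply: (@continuousB _ _ _ (coord c) (cst v0)); first exact: coord_continuous_at.
    exact: cst_continuous.
  have h2 : \forall y \near z, `|coord c y - v0| < r := cn _ (near_norm_lt zr).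
  by apply: filterS2 (near_chart_dom hc Dz) h2 => y.
have Ux : U x by split=> //; rewrite subrr normr0.
have [chi [chix chi0 chiU chiS]] := bump oU Ux.
pose A i z := chi z * (coord c z - v0) 0 i.
pose C i z := chi z * G i (coord c z - v0).
have sA i : smooth_function (A i).
  apply: chiS => z [Dz zr].
  apply: (@smooth_near_coord _ _ _ _ (fun u => (u - v0) 0 i) ac Dz) => k.
  by apply: (@Cshift k (fun u => u 0 i)); exact: Ck_coord.
have sC i : smooth_function (C i).
  apply: chiS => z [Dz zr].
  apply: (@smooth_near_coord _ _ _ _ (fun u => G i (u - v0)) ac Dz) => k.
  by apply: (@Cshift k (G i)); exact: CG.
have schi : smooth_function chi.
  have := chiS (fun=> 1) (fun z _ => smooth_near_cst 1 z).
  by under eq_fun do rewrite mulr1.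
(* On [U] this is Hadamard's formula, one factor [chi] going to each of [A i] and [C i]; off [U]
   both sides vanish. *)
have E : (fun z => (chi z * chi z) * f z) = (fun z => \sum_i A i z * C i z).
  apply/funext => z; have [[Dz zr]|nUz] := pselect (U z); last first.
    by rewrite chiU// !mul0r big1// => i _; rewrite /A chiU// !mul0r.
  have := hadamard (fun l w => @Ch l w) zr.
  rewrite h0 add0r {1}/h subrK coordK// => ->.
  rewrite mulr_sumr; apply: eq_bigr => i _; rewrite /A /C -/(G i); ring.
have : v (fun z => (chi z * chi z) * f z) = v (fun z => \sum_i A i z * C i z) by rewrite E.
rewrite tangentM//; last exact: smoothM.
rewrite chix fx0 mulr0 addr0 !mul1r => ->.
rewrite tangent_sum => [|i]; last exact: smoothM.
apply: big1 => i _; rewrite tangentM// /A /C subrr mxE !mulr0 mul0r add0r.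
rewrite /G /radial (_ : (fun t : R => _) = (fun=> 0)).
  by rewrite Rintegral01_cst mulr0 mulr0.
by apply/funext => t; rewrite scaler0 dh0 mulr0.
Qed.

End Derivations.

(** * Pullbacks and local sections of fibrations *)

Section SmoothMaps.
Variables (R : realType) (M N : smoothManifold R).

Lemma smooth_near_comp (p : M -> N) (f : N -> R) x :
  smooth_map p -> smooth_near f (p x) -> smooth_near (f \o p) x.
Proof.
move=> sp sf; have [c [ac Dx]] := atlas_cover x; have [d [ad Dpx]] := atlas_cover (p x).
exists c; split=> // k.
apply: (Ck_comp_smooth_map_on (atlas_charts ac) (atlas_charts ad) ac ad (@openT M) sp) => //.
exact: smooth_nearP.
Qed.

Lemma smooth_comp (p : M -> N) (f : N -> R) :
  smooth_map p -> smooth_function f -> smooth_function (f \o p).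
Proof. by move=> sp /smooth_functionP sf; apply/smooth_functionP => x; exact: smooth_near_comp. Qed.

Lemma smooth_map_continuous (p : M -> N) : smooth_map p -> continuous p.
Proof. by case=> cp _; apply/continuous_subspace_setT. Qed.

(** In product charts the slice is v -> (v, [coord e s]), with components that are coordinates or
    constants. *)
Lemma smooth_near_slice (F : smoothManifold R) (U : set N)
    (Psi : prod_space N F -> M) (g : M -> R) (y : N) (s : F) :
  open U -> smooth_map_on (U `*` [set: F] : set (prod_space N F)) Psi -> U y ->
  smooth_near g (Psi (y, s)) -> smooth_near (fun z => g (Psi (z, s))) y.
Proof.
move=> oU sPsi Uy sg.
have [c [ac Dy]] := atlas_cover y; have [e [ae Ds]] := atlas_cover s.
have [d [ad Dd]] := atlas_cover (Psi (y, s)).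
exists c; split=> // k.
have oA : open (U `*` [set: F] : set (prod_space N F)).
  apply: open_near => -[z t] [/= Uz _].
  by exists (U, setT) => //; split; [exact: near_open|exact: filterT].
have ace : atlas (c := prod_space N F) (prod_chart c e) by exists c, e.
have hce := prod_chart_axiom (atlas_charts ac) (atlas_charts ae).
have C := @Ck_comp_smooth_map_on _ _ _ _ Psi g _ d (y, s) k hce (atlas_charts ad)
  ace ad oA sPsi (conj Dy Ds) (conj Uy I) Dd (smooth_nearP sg ad Dd k).
apply: (@near_eq_Ck _ _ _ ((g \o Psi \o param (prod_chart c e)) \o (fun v => row_mx v (coord e s)))).
  by apply: nbhs_all => v /=; rewrite row_mxKl row_mxKr coordK//; exact: atlas_charts.
apply: (@Ck_comp _ _ _ _ (g \o Psi \o param (prod_chart c e))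
  (fun v : 'rV[R]_(dim N) => row_mx v (coord e s)) _ C) => j; case: (split_ordP j) => i ->.
  apply: (@near_eq_Ck _ _ _ (fun v : 'rV[R]_(dim N) => v 0 i)); last exact: Ck_coord.
  by apply: nbhs_all => v; rewrite row_mxEl.
apply: (@near_eq_Ck _ _ _ (cst (coord e s 0 i))); last exact: Ck_cst.
by apply: nbhs_all => v; rewrite row_mxEr.
Qed.

(** The section keeps the fibre coordinate of [x] in a local trivialization fixed. *)
Lemma fibration_section (p : M -> N) (x : M) : smooth_fibration p ->
  exists (U : set N) (sigma : N -> M),
    [/\ open U, U (p x), sigma (p x) = x, forall y, U y -> p (sigma y) = y &
        forall g y, U y -> smooth_near g (sigma y) -> smooth_near (g \o sigma) y].
Proof.
move=> [_ _ [F /(_ (p x))[U [Phi [Psi [oU Ux [_ sPsi PhiK PsiK] pPhi]]]]]].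
exists U, (fun y => Psi (y, (Phi x).2)); split=> //.
- by rewrite -pPhi// -surjective_pairing; have [] := PhiK x Ux.
- move=> y Uy; have [Upsi PhiPsi] := PsiK (y, (Phi x).2) (conj Uy I).
  by rewrite -pPhi// PhiPsi.
- by move=> g y Uy sg; exact: (smooth_near_slice oU sPsi).
Qed.

End SmoothMaps.

(** * The maximum principle *)

Section FieldsAndMaxima.
Variables (R : realType) (M N : smoothManifold R).
Variables (X : vectorField M) (Y : vectorField N) (p : M -> N).
Hypothesis fp : smooth_fibration p.
Hypothesis pX : forall x : M, tangent_eq (differential p (X x)) (Y (p x)).

Lemma related_field x (f : N -> R) : smooth_function f -> X x (f \o p) = Y (p x) f.
Proof. exact: pX. Qed.

Let sp : smooth_map p. Proof. by case: fp. Qed.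

(* The fibre product of M with itself over N need not be given a manifold
   structure: with sections s1, s2 of p through x1, x2, each of the functions
   a + b o s2 o p (at x1), b + a o s1 o p (at x2) and a o s1 + b o s2 (at p x1) is
   maximal, and the three resulting equations combine. *)
Lemma fiber_max (a b : M -> R) (x1 x2 : M) :
  smooth_function a -> smooth_function b -> p x1 = p x2 ->
  (forall z1 z2, p z1 = p z2 -> a z1 + b z2 <= a x1 + b x2) ->
  X x1 a + X x2 b = 0.
Proof.
move=> sa sb p12 abmax.
(* With values 0 at the base points, multiplying by a cutoff equal to 1 there does not change
   derivatives. *)
pose a' z := a z + - a x1; pose b' z := b z + - b x2.
have sa' : smooth_function a' by apply: smoothD => //; exact: smooth_cst.
have sb' : smooth_function b' by apply: smoothD => //; exact: smooth_cst.
have Xa' : X x1 a' = X x1 a.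
  by rewrite (tangentD (vf_tangent X x1))// ?(tangent_cst (vf_tangent X x1)) ?addr0//; exact: smooth_cst.
have Xb' : X x2 b' = X x2 b.
  by rewrite (tangentD (vf_tangent X x2))// ?(tangent_cst (vf_tangent X x2)) ?addr0//; exact: smooth_cst.
have ab0 z1 z2 : p z1 = p z2 -> a' z1 + b' z2 <= 0.
  by move=> /abmax; rewrite /a' /b'; lra.
pose y := p x1.
have [U1 [s1 [oU1 U1y s1y ps1 ss1]]] := fibration_section x1 fp.
have [U2 [s2 [oU2 U2y s2y ps2 ss2]]] := fibration_section x2 fp.
pose U := U1 `&` U2.
have oU : open U by exact: openI.
have Uy : U y by split=> //; rewrite /y p12.
have [chi [chiy chi0 chiU chiS]] := bump oU Uy.
have schi : smooth_function chi.
  have := chiS (fun=> 1) (fun z _ => smooth_near_cst 1 z).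
  by under eq_fun do rewrite mulr1.
pose al z := chi z * a' (s1 z); pose be z := chi z * b' (s2 z).
have sal : smooth_function al.
  by apply: chiS => z [Uz _]; apply: ss1 => //; move/smooth_functionP : sa'; apply.
have sbe : smooth_function be.
  by apply: chiS => z [_ Uz]; apply: ss2 => //; move/smooth_functionP : sb'; apply.
have a'0 : a' x1 = 0 by rewrite /a' subrr.
have b'0 : b' x2 = 0 by rewrite /b' subrr.
(* Where [p z] lies in [U], the test function is (chi o p)(f + g o s o p), nonpositive because z and
   s (p z) share a fibre; elsewhere it is 0. *)
have half (f g : M -> R) (ga : N -> R) (s : N -> M) x : p x = y ->
    smooth_function f -> smooth_function ga -> (forall z, ga z = chi z * g (s z)) ->
    (forall z, U z -> p (s z) = z) -> f x = 0 -> g (s y) = 0 ->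
    (forall z1 z2, p z1 = p z2 -> f z1 + g z2 <= 0) -> X x f + Y y ga = 0.
  move=> pxy sf sga gaE ps fx0 gx0 fg0.
  have schip := smooth_comp sp schi; have sgap := smooth_comp sp sga.
  have tX := vf_tangent X x.
  have E : X x (fun z => (chi \o p) z * f z + (ga \o p) z) = X x f + Y y ga.
    rewrite (tangentD tX)//; last exact: smoothM.
    by rewrite (tangentM tX)// (related_field x sga)/= pxy chiy fx0 mul1r mulr0 addr0.
  rewrite -E; apply: (tangent_max tX); first by apply: smoothD => //; exact: smoothM.
    by rewrite /= fx0 gaE pxy gx0 !mulr0 addr0.
  move=> z; rewrite /= gaE -mulrDr; have [Uz|nUz] := pselect (U (p z)).
    by rewrite mulr_ge0_le0// fg0// ps.
  by rewrite chiU// mul0r.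
have h1 : X x1 a' + Y y be = 0.
  apply: (@half a' b' be s2) => //.
  - by move=> z [_ Uz]; exact: ps2.
  - by rewrite /y p12 s2y.
have h2 : X x2 b' + Y y al = 0.
  apply: (@half b' a' al s1) => //.
  - by move=> z [Uz _]; exact: ps1.
  - by rewrite /y s1y.
  - by move=> z1 z2 z12; rewrite addrC ab0.
have h3 : Y y al + Y y be = 0.
  have tY := vf_tangent Y y; rewrite -(tangentD tY)//.
  apply: (tangent_max tY); first exact: smoothD.
    by rewrite /al /be /y {1}s1y p12 s2y a'0 b'0 !mulr0 addr0.
  move=> z; rewrite /al /be -mulrDr; have [[Uz1 Uz2]|nUz] := pselect (U z).
    by rewrite mulr_ge0_le0// ab0// ps1// ps2.
  by rewrite chiU// mul0r.
(* The combination is [h1] + [h2] - [h3]. *)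
by rewrite -Xa' -Xb'; lra.
Qed.

End FieldsAndMaxima.

(** * Functions monotone along a cohomology free field *)

Section CohomologyFree.
Variables (R : realType) (M : smoothManifold R) (X : vectorField M).
Hypothesis cM : compact [set: M].
Hypothesis cfX : cohomology_free X.

Lemma field_max (f : M -> R) x : smooth_function f -> (forall z, f z <= f x) ->
  X x f = 0.
Proof.
move=> sf fx; have tX := vf_tangent X x.
have <- : X x (fun z => f z + - f x) = X x f.
  by rewrite (tangentD tX)// ?(tangent_cst tX) ?addr0//; exact: smooth_cst.
apply: (tangent_max tX); first by apply: smoothD => //; exact: smooth_cst.
  by rewrite subrr.
by move=> z; rewrite subr_le0.
Qed.

Lemma smooth_continuous (f : M -> R) : smooth_function f -> continuous f.
Proof. by move=> /smooth_functionP sf x; exact: smooth_near_continuous. Qed.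

Lemma smooth_has_max (x0 : M) (f : M -> R) : smooth_function f ->
  exists x, forall z, f z <= f x.
Proof.
move=> sf; have [||c _ Hc] := @compact_EVT_max M R f setT _ cM.
- by exists x0.
- by apply: continuous_subspaceT; exact: smooth_continuous.
by exists c => z; apply: Hc; exact/mem_set.
Qed.

Lemma smoothZ (a : R) (f : M -> R) : smooth_function f -> smooth_function (fun z => a * f z).
Proof. by move=> sf; apply: smoothM => //; exact: smooth_cst. Qed.

Lemma smooth_bounded (f : M -> R) : smooth_function f ->
  exists C, forall z, `|f z| <= C.
Proof.
move=> sf; have [x0|nM] := pselect (exists x : M, True); last first.
  by exists 0 => z; exfalso; apply: nM; exists z.
case: x0 => x0 _; have [x Hx] := smooth_has_max x0 sf.
have [y Hy] := smooth_has_max x0 (smoothZ (-1) sf).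
exists (Num.max (f x) (- f y)) => z; rewrite ler_norml le_max Hx /= andbT.
by rewrite lerNl le_max; apply/orP; right; have := Hy z; rewrite !mulN1r.
Qed.

(* If X r = s + c, then at a maximum of r + e K s one has s + c + e K X s = 0, so
   e s <= - e c there; as K grows, this maximum approaches that of e s. Both signs
   e = 1 and e = -1 give s = - c. *)
Lemma nonneg_lie_derivative_cst (s : M -> R) : smooth_function s ->
  (forall z, 0 <= X z s) -> exists a, forall z, s z = a.
Proof.
move=> ss Xs; have [c [r [sr Xr]]] := cfX ss.
have [C HC] := smooth_bounded sr.
exists (- c) => z; apply/eqP; rewrite eq_le.
have key (e : R) : e = 1 \/ e = -1 -> e * s z <= e * - c.
  move=> He; have ee : e * e = 1 by case: He => ->; rewrite ?mulr1 ?mulrNN ?mulr1.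
  rewrite leNgt; apply/negP => H.
  pose del := e * s z - e * - c; have del0 : 0 < del by rewrite subr_gt0.
  have C0 : 0 <= C by exact: le_trans (HC z).
  (* At the maximum x, e s(x) <= - e c, so K (e s(z) - e s(x)) >= K del = 2C + 1, more than the
     oscillation of [r] allows. *)
  pose K := (2 * C + 1) / del; have K0 : 0 < K by rewrite divr_gt0//; lra.
  have sK := smoothZ (e * K) ss; have sF := smoothD sr sK.
  have [x Hx] := smooth_has_max z sF.
  have tX := vf_tangent X x.
  have := field_max sF Hx; rewrite (tangentD tX)// (tangentZ tX)//.
  rewrite (Xr x : X x r = _) => E.
  have E' : e * s x = e * - c - K * X x s.
    have -> : s x = - c - e * K * X x s by lra.
    by rewrite mulrBr !mulrA ee mul1r.
  have Kh : 0 <= K * X x s by rewrite mulr_ge0// ltW.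
  have Kdel : K * del = 2 * C + 1 by rewrite /K divfK// gt_eqF.
  have dx : K * del <= K * (e * s z - e * s x) by rewrite ler_pM2l// /del; lra.
  have := Hx z; have := HC z; have := HC x; rewrite !ler_norml => /andP[_ rx] /andP[rz _].
  have -> : e * K * s z = e * K * s x + K * (e * s z - e * s x) by ring.
  lra.
apply/andP; split; first by have := key 1 (or_introl erefl); lra.
by have := key (-1) (or_intror erefl); lra.
Qed.

End CohomologyFree.

(** * Constancy on the fibres and descent to the base *)

Lemma lie_eq_const_on_fibers (R : realType) (M N : smoothManifold R)
    (X : vectorField M) (Y : vectorField N) (p : M -> N) (u : M -> R) (g : N -> R) :
  compact [set: M] -> cohomology_free X -> smooth_fibration p ->
  (forall x : M, tangent_eq (differential p (X x)) (Y (p x))) ->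
  smooth_function u -> (forall x, X x u = g (p x)) ->
  forall x1 x2, p x1 = p x2 -> u x1 = u x2.
Proof.
move=> cM cfX fp pX su Xu.
have [x0|nM] := pselect (exists x : M, True); last first.
  by move=> x1; exfalso; apply: nM; exists x1.
case: x0 => x0 _.
have cp : continuous p by apply: smooth_map_continuous; case: fp.
pose P := [set z : M * M | p z.1 = p z.2].
(* [N] is Hausdorff: preimages of disjoint neighbourhoods of p x and p y separate (x, y) from
   [P]. *)
have clP : closed P.
  rewrite -[P]setCK; apply: open_closedC; apply: open_near => -[x y] /= /eqP nxy.
  have := @manifold_hausdorff R N; rewrite open_hausdorff => /(_ (p x) (p y) nxy).
  move=> [[A B] /= [/set_mem Ax /set_mem By] [oA oB /eqP AB]].
  exists (p @^-1` A, p @^-1` B) => /=.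
    by split; [exact: cp (near_open oA Ax)|exact: cp (near_open oB By)].
  move=> [z t] /= [Az Bt] zt.
  have : (A `&` B) (p z) by split=> //; rewrite zt.
  by rewrite AB.
have cP : compact P.
  apply: (subclosed_compact clP (compact_setX cM cM)); by move=> z.
have Pmax (a b : M -> R) : smooth_function a -> smooth_function b ->
    exists x1 x2, p x1 = p x2 /\
      forall z1 z2, p z1 = p z2 -> a z1 + b z2 <= a x1 + b x2.
  move=> sa sb.
  have ca := smooth_continuous sa; have cb := smooth_continuous sb.
  have [||[x1 x2] /set_mem/= Px Hx] := @compact_EVT_max _ R (fun z : M * M => a z.1 + b z.2) P _ cP.
  - by exists (x0, x0).
  - apply: continuous_subspaceT => z; apply: cvgD.
      by apply: (@continuous_comp _ _ _ fst a); [exact: cvg_fst|exact: ca].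
    by apply: (@continuous_comp _ _ _ snd b); [exact: cvg_snd|exact: cb].
  exists x1, x2; split=> // z1 z2 pz; exact: (Hx (z1, z2) (mem_set pz)).
have [m1 [m2 [pm Hm]]] := Pmax _ _ su (smoothZ (-1) su).
pose d := u m1 - u m2.
have dmax z1 z2 : p z1 = p z2 -> u z1 - u z2 <= d by move=> /Hm; rewrite /d; lra.
(* Exchanging the two points gives the opposite inequality. *)
suff d0 : d <= 0.
  move=> x1 x2 p12; have := dmax _ _ p12; have := dmax _ _ (esym p12); lra.
rewrite leNgt; apply/negP => d0.
have [xm Hxm] := smooth_has_max cM x0 (smoothZ (-1) su).
have um z : u xm <= u z by have := Hxm z; lra.
pose h z := flat 0 (u xm + d / 2 + -1 * u z).
have sh : smooth_function h.
  apply/smooth_functionP => z; apply: smooth_near_flat.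
  apply: smooth_nearD; first exact: smooth_near_cst.
  by move/smooth_functionP : (smoothZ (-1) su); apply.
have [c [s [ss Xs]]] := cfX h sh.
have [C HC] := smooth_bounded cM ss.
have C0 : 0 <= C by exact: le_trans (HC x0).
(* Comparison with (m1, m2) gives K (u x1 - u x2) >= K d - 2C, and K d > 4C makes this at least K d
   / 2. *)
pose K := (4 * C + 1) / d; have K0 : 0 < K by rewrite divr_gt0//; lra.
have Kd : K * d = 4 * C + 1 by rewrite /K divfK// gt_eqF.
have sa := smoothD (smoothZ K su) ss; have sb := smoothZ (- K) su.
have [x1 [x2 [p12 H12]]] := Pmax _ _ sa sb.
(* The terms K g (p x1) and - K g (p x2) cancel, leaving only X s at x1. *)
have := fiber_max fp pX sa sb p12 H12.
have t1 := vf_tangent X x1; have t2 := vf_tangent X x2.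
rewrite (tangentD t1)//; last exact: smoothZ.
rewrite (tangentZ t1)// (tangentZ t2)// !Xu p12.
rewrite (Xs x1 : X x1 s = _) => hc.
have Dd : d / 2 <= u x1 - u x2.
  have := H12 _ _ pm; have := HC m1; have := HC x1.
  rewrite !ler_norml => /andP[_ b1] /andP[b2 _] b3.
  have b4 : K * d - 2 * C <= K * (u x1 - u x2) by rewrite /d; lra.
  rewrite -(ler_pM2l K0); lra.
(* Indeed u x1 >= u x2 + d/2 >= min u + d/2. *)
have h0 : h x1 = 0 by rewrite /h flat0//; have := um x2; lra.
have c0 : c = 0 by lra.
have [|k Hk] := nonneg_lie_derivative_cst cM cfX ss.
  by move=> z; rewrite (Xs z : X z s = _) c0 addr0 flat_ge0.
have : X xm s = h xm by rewrite (Xs xm : X xm s = _) c0 addr0.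
rewrite (_ : s = fun=> k); last exact/funext.
rewrite (tangent_cst (vf_tangent X xm)) => /esym/eqP.
by rewrite gt_eqF// /h flat_gt0//; lra.
Qed.

Theorem proposition1p3 (R : realType) (M N : smoothManifold R)
    (X : vectorField M) (Y : vectorField N) (p : M -> N) :
  compact [set: M]%classic ->
  connected [set: M]%classic ->
  cohomology_free X ->
  smooth_fibration p ->
  (forall x : M, tangent_eq (differential p (X x)) (Y (p x))) ->
  cohomology_free Y.
Proof.
move=> cM _ cfX fp pX phi sphi.
have sp : smooth_map p by case: fp.
have psurj : forall y, exists x, p x = y by case: fp.
have [c [u [su Xu]]] := cfX _ (smooth_comp sp sphi).
have ufib := lie_eq_const_on_fibers (g := fun y => phi y + c) cM cfX fp pX su Xu.
(* [s] is a mere set-theoretic section; constancy on fibres makes u o s independent of it, so near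
   each point it may be replaced by a smooth local section. *)
have [s ps] := choice psurj.
have sw : smooth_function (u \o s).
  apply/smooth_functionP => y; have [U [sg [oU Uy sgy psg ssg]]] := fibration_section (s y) fp.
  rewrite ps in Uy sgy.
  apply: (@near_eq_smooth _ _ (u \o sg)).
    have := near_open oU Uy; apply: filterS => z Uz.
    by apply: ufib; rewrite psg.
  by apply: ssg => //; move/smooth_functionP : su; apply.
exists c, (u \o s); split=> // y.
rewrite /lie_derivative -(ps y) -(related_field pX _ sw).
have -> : (u \o s) \o p = u by apply/funext => x; apply: ufib; rewrite /= ps.
exact: Xu.
Qed.
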